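(* Let $p>3$, $q>3$ be integers with $(p-2)(q-2)>4$, and let $a_i$ and $b_i$ be the numbers of the vertices of type $A$ (non-roots) and of type $B$ (roots), respectively, on level $i$ of the regular hyperbolic mosaic $\{p,q\}$. Put $c=(p-2)(q-2)-2$ and $z_1=\frac{c+\sqrt{c^2-4}}{2}$. Then $$\lim_{i\to\infty}\frac{a_{i+1}}{a_i}=\lim_{i\to\infty}\frac{b_{i+1}}{b_i}=\lim_{i\to\infty}\frac{a_{i+1}+b_{i+1}}{a_i+b_i}=z_1\qquad (i\ge 1).$$
   Context: Consider the regular planar mosaic with Schläfli symbol $\{p,q\}$ (regular $p$-gonal cells, $q$ of them around each vertex); it is Euclidean if $(p-2)(q-2)=4$ and hyperbolic if $(p-2)(q-2)>4$. Fix a vertex $B_0$ of the mosaic. Belts: belt $0$ is the vertex $B_0$. Belt $1$ consists of the cells having a common point with $B_0$. If belt $i$ is known, belt $i+1$ consists of the cells that have a common point (not necessarily a common vertex) with belt $i$ but have none with belt $i-1$. Levels: level $0$ (layer $0$) is $B_0$; for $i\ge1$, level $i$ (layer $i$) is the outer boundary of belt $i$, and the vertices on level $i$ are the vertices of the mosaic lying on it. Trees: tree graphs are built recursively along the edges of the mosaic. $B_0$ is a root (the main root). From level $i-1$ to level $i$ the maximum number of mosaic edges joining level $i-1$ to level $i$ is used, subject to each vertex on level $i$ being connected to at most one vertex of level $i-1$, and no vertex of level $i-1$ being left as a leaf; edges joining two vertices of the same level are never used. The vertices on level $i$ that are not connected to a vertex of level $i-1$ become roots of new trees. Roots are called vertices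 of type $B$ and all other vertices are of type $A$. The numbers of the vertices of types $A$ and $B$ on level $i$ are denoted by $a_i$ and $b_i$, respectively. One has $a_0=0$, $b_0=1$, $a_1=q$, $b_1=q(p-3)$. *)

(* Defs.v *)
From HB Require Import structures.
From mathcomp Require Import all_boot all_order all_algebra.
From mathcomp Require Import finmap.
From mathcomp Require Import all_classical all_reals all_analysis.

Set Implicit Arguments.
Unset Strict Implicit.
Unset Printing Implicit Defensive.

Import Order.TTheory GRing.Theory Num.Theory.
Import numFieldNormedType.Exports.

Local Open Scope classical_set_scope.
Local Open Scope ring_scope.

(* The hyperbolic plane is the upper sheet of the hyperboloid in Minkowski
   space: the isometries are linear, the distance d satisfies
   cosh (d x y) = - lorentz x y, and the topology is that of R^3. *)
Definition lorentz (R : realType) (x y : 'rV[R]_3) : R :=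
  x 0 0 * y 0 0 + x 0 1 * y 0 1 - x 0 ord_max * y 0 ord_max.

Definition hyperbolic_plane (R : realType) : set 'rV[R]_3 :=
  [set x | lorentz x x = -1 /\ 0 < x 0 ord_max].

Definition row3 (R : realType) (a b c : R) : 'rV[R]_3 :=
  \row_(j < 3) [:: a; b; c]`_j.

(* The Euclidean cross product with its last coordinate negated, so that it is
   orthogonal to x and y for lorentz rather than for the scalar product. *)
Definition line_normal (R : realType) (x y : 'rV[R]_3) : 'rV[R]_3 :=
  row3 (x 0 1 * y 0 ord_max - x 0 ord_max * y 0 1)
       (x 0 ord_max * y 0 0 - x 0 0 * y 0 ord_max)
       (x 0 1 * y 0 0 - x 0 0 * y 0 1).

(* The hyperbolic reflection in the line through x and y (x <> y). *)
Definition reflection (R : realType) (x y z : 'rV[R]_3) : 'rV[R]_3 :=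
  let n := line_normal x y in
  z - (2 * lorentz z n / lorentz n n) *: n.

(* The convex polygon with vertices v: geodesics are the sections of the
   hyperboloid by planes through 0, so the hyperbolic convex hull is the trace
   of the cone spanned by the vertices. *)
Definition polygon (R : realType) (n : nat) (v : 'I_n -> 'rV[R]_3) :
    set 'rV[R]_3 :=
  [set x | hyperbolic_plane x /\
     exists2 l : 'I_n -> R, (forall k, 0 <= l k) & x = \sum_k l k *: v k].

Section Mosaic.
Variables (R : realType) (p q : nat).

(* The regular p-gon of angle 2 pi / q centred at (0, 0, 1).  The centre, a
   vertex and the midpoint of an incident side form a triangle of angles pi / p,
   pi / q, pi / 2, whose hypotenuse r, the circumradius, is given by
   cosh r = cot (pi / p) cot (pi / q). *)
Definition base_cell (k : 'I_p) : 'rV[R]_3 :=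
  let cosh_r := (tan (pi / p%:R))^-1 * (tan (pi / q%:R))^-1 in
  let sinh_r := Num.sqrt (cosh_r ^+ 2 - 1) in
  let theta := 2 * pi * k%:R / p%:R in
  row3 (sinh_r * cos theta) (sinh_r * sin theta) cosh_r.

(* The cells of {p,q}, as the cyclic sequences of their vertices: the angle
   2 pi / q lets exactly q copies of the base cell fit around a vertex, and the
   mosaic consists of the polygons reached from it by successive reflections in
   sides.  One polygon may be reached with several labellings of its vertices. *)
Inductive cell_vertices : ('I_p -> 'rV[R]_3) -> Prop :=
| cell_base : cell_vertices base_cell
| cell_reflect c (k : 'I_p) : cell_vertices c ->
    cell_vertices (fun j => reflection (c k) (c (ordS k)) (c j)).

Definition cell (C : set 'rV[R]_3) : Prop :=
  exists2 c, cell_vertices c & C = polygon c.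

Definition mosaic_vertex (v : 'rV[R]_3) : Prop :=
  exists2 c, cell_vertices c & exists k, v = c k.

Definition mosaic_edge (u v : 'rV[R]_3) : Prop :=
  exists2 c, cell_vertices c &
    exists k, (u = c k /\ v = c (ordS k)) \/ (v = c k /\ u = c (ordS k)).

Variable B0 : 'rV[R]_3.

Definition region (T : set (set 'rV[R]_3)) : set 'rV[R]_3 :=
  \bigcup_(C in T) C.

Fixpoint belt (i : nat) : set (set 'rV[R]_3) :=
  match i with
  | 0 => [set [set B0]]
  | i'.+1 =>
    match i' with
    | 0 => [set C | cell C /\ C `&` [set B0] !=set0]
    | j.+1 => [set C | [/\ cell C, C `&` region (belt i') !=set0
                         & C `&` region (belt j) = set0]]
    end
  end.

(* The topological boundary relative to the hyperbolic plane. *)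
Definition boundary (U : set 'rV[R]_3) : set 'rV[R]_3 :=
  [set x | [/\ hyperbolic_plane x, closure U x &
               closure (@hyperbolic_plane R `\` U) x]].

(* The outer boundary of belt i is the boundary of belts 0, ..., i together:
   the inner boundary of belt i is filled in by the preceding belts. *)
Definition level (i : nat) : set 'rV[R]_3 :=
  match i with
  | 0 => [set B0]
  | _.+1 => boundary (\bigcup_(j in [set j | (j <= i)%N]) region (belt j))
  end.

Definition level_vertex (i : nat) : set 'rV[R]_3 :=
  [set v | mosaic_vertex v /\ level i v].

(* The sets of tree edges allowed between level i and level i.+1, an edge being
   a pair (vertex on level i, vertex on level i.+1).  By the last clause every
   vertex on level i has a child, i.e. none is left as a leaf. *)
Definition admissible (i : nat) (E : set ('rV[R]_3 * 'rV[R]_3)) : Prop :=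
  [/\ forall u v, E (u, v) ->
        [/\ level_vertex i u, level_vertex i.+1 v & mosaic_edge u v],
      forall u u' v, E (u, v) -> E (u', v) -> u = u' &
      forall u, level_vertex i u -> exists v, E (u, v)].

(* E i is the set of tree edges from level i to level i.+1. *)
Definition tree_graphs (E : nat -> set ('rV[R]_3 * 'rV[R]_3)) : Prop :=
  forall i, admissible i (E i) /\
    forall E', admissible i E' -> (E' #<= E i)%card.

Definition type_A (E : nat -> set ('rV[R]_3 * 'rV[R]_3)) (i : nat) :
    set 'rV[R]_3 :=
  match i with
  | 0 => set0
  | j.+1 => [set v | level_vertex j.+1 v /\ exists u, E j (u, v)]
  end.

Definition type_B (E : nat -> set ('rV[R]_3 * 'rV[R]_3)) (i : nat) :
    set 'rV[R]_3 :=
  level_vertex i `\` type_A E i.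

(* fset_set is the empty fset on infinite sets, but levels are finite. *)
Definition num_A (E : nat -> set ('rV[R]_3 * 'rV[R]_3)) (i : nat) : nat :=
  #|` fset_set (type_A E i)|.

Definition num_B (E : nat -> set ('rV[R]_3 * 'rV[R]_3)) (i : nat) : nat :=
  #|` fset_set (type_B E i)|.

End Mosaic.

(* Main.v *)
Require Import Defs.
From HB Require Import structures.
From mathcomp Require Import all_boot all_order all_algebra.
From mathcomp Require Import all_classical all_reals all_analysis.
From mathcomp Require Import finmap zify ring lra.
Import Order.TTheory GRing.Theory Num.Theory.
Import numFieldNormedType.Exports.
Local Open Scope classical_set_scope.
Local Open Scope ring_scope.

(* Each cell of a belt meets the union of the previous belts in a vertex or in
   an edge, so the vertices of level i.+1 are read off from those of level i by
   a substitution.  This yields an explicit combinatorial {p,q} map, whose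
   vertices are addresses (words of child indices) and whose flags carry an
   action of the Coxeter generators s_0, s_1, s_2.  Going down from child to
   parent defines a developing map from its flags to frames of Minkowski space,
   equivariant under the generators.

   Tits' argument (a root of a chamber is a nonnegative or a nonpositive
   combination of the roots of any other chamber, by induction on the distance
   of the flags) applies to this flag graph without any presentation of the
   group: two chambers share a point only if they are linked by generators
   fixing that point.  Hence the developing map is injective, the polygons of
   the mosaic are the images of the faces of the map, belt i consists of the
   faces of bottom level i - 1, and the vertices on level i are the addresses of
   length i.  For p, q > 3 each vertex of level i.+1 has at most one neighbour
   on level i and each vertex of level i has a neighbour on level i.+1, so the
   tree edges are all the edges between consecutive levels.  Counting addresses,
   a and b satisfy u_{i+2} = c u_{i+1} - u_i, and the dominant root of
   z^2 - c z + 1 is z_1. *)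

Set Implicit Arguments.
Unset Strict Implicit.
Unset Printing Implicit Defensive.


(** * The combinatorial mosaic *)

(** The definition of the mosaic says only which cells arise by reflections. It does not say that
    distinct cells do not overlap, how many surround a vertex or which of them meet, and belts and
    boundaries depend on exactly that. In the combinatorial map these incidences hold by
    construction; what the geometry must supply is a Gram matrix realised in Minkowski space and the
    positivity of Chebyshev numbers for each pair of generators.

    The constants come from the shape of a level i > 0. Of the q edges at a vertex, two run along
    the level and one descends if the vertex is a child, which leaves q - 2 or q - 3 going up. A
    face between two consecutive children has p - 1 vertices on the next level, a face standing on
    an edge of the level has p - 2. Counting each shared child once gives a block of p - 2 vertices
    per child, the last block being one shorter because its face has two bottom vertices. The root
    has no level edge, whence the full q * (p - 2). *)

Section Map.
Local Open Scope nat_scope.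
Variables p q : nat.
Hypotheses (hp : 3 < p) (hq : 3 < q).

(* The address [m :: u] denotes the m-th (from 0) vertex of the next level
   between the first child of u (included) and the first child of the right
   neighbour of u (excluded); the children of u are those with p - 2 dividing m. *)
Definition is_child (v : seq nat) : bool :=
  if v is m :: _ then p - 2 %| m else false.

Definition nout (v : seq nat) : nat :=
  if v is [::] then q else if is_child v then q - 3 else q - 2.

Definition nsucc (v : seq nat) : nat :=
  if v is [::] then q * (p - 2) else (nout v * (p - 2)).-1.

Fixpoint vaddr (v : seq nat) : bool :=
  if v is m :: u then (m < nsucc u) && vaddr u else true.

(** Right neighbour in the cyclic order of the level, as an odometer: past the last vertex below u
    comes the first one below the right neighbour of u. *)
Fixpoint nxt (v : seq nat) : seq nat :=
  if v is m :: u then if m.+1 < nsucc u then m.+1 :: u else 0 :: nxt u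
  else [::].

Fixpoint prv (v : seq nat) : seq nat :=
  if v is m :: u then
    if m is m'.+1 then m' :: u else (nsucc (prv u)).-1 :: prv u
  else [::].

Lemma nout_gt0 v : 0 < nout v.
Proof. by case: v => [|m u] /=; [lia | case: ifP; lia]. Qed.

Lemma nout_le v : nout v <= q.
Proof. by case: v => [|m u] /=; [lia | case: ifP; lia]. Qed.

Lemma nout_cons m u : nout (m :: u) <= q - 2.
Proof. by rewrite /=; case: ifP; lia. Qed.

Lemma nsucc_gt0 v : 0 < nsucc v.
Proof.
have := nout_gt0 v; case: v => [|m u] /=; first by move=> _; nia.
by move=> h; have : (if p - 2 %| m then q - 3 else q - 2) * (p - 2) >= p - 2;
  [nia | lia].
Qed.

Lemma nsucc_nout k v : ((p - 2) * k < nsucc v) = (k < nout v).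
Proof.
by case: v => [|m u]; rewrite /nsucc; [rewrite /=; nia | move: (nout _) => n; nia].
Qed.

Lemma div_nout m v : m < nsucc v -> m %/ (p - 2) < nout v.
Proof.
move=> h; rewrite ltn_divLR; last lia.
by case: v h => [|a u]; rewrite /nsucc //; move: (nout _) => n; lia.
Qed.

Lemma size_nxt v : size (nxt v) = size v.
Proof. by elim: v => //= m u IH; case: ifP => //= _; rewrite IH. Qed.

Lemma size_prv v : size (prv v) = size v.
Proof. by elim: v => //= -[|m] u IH //=; rewrite IH. Qed.

Lemma vaddr_nxt v : vaddr v -> vaddr (nxt v).
Proof.
elim: v => //= m u IH /andP[h hu]; case: ifP => /= [->|_]; first by rewrite hu.
by rewrite nsucc_gt0 IH.
Qed.

Lemma vaddr_prv v : vaddr v -> vaddr (prv v).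
Proof.
elim: v => //= -[|m] u IH /andP[h hu] /=; last by rewrite hu andbT; lia.
by rewrite IH // andbT; have := nsucc_gt0 (prv u); lia.
Qed.

Lemma prvK v : vaddr v -> nxt (prv v) = v.
Proof.
elim: v => //= -[|m] u IH /andP[h hu] /=; last by rewrite h.
have h' := nsucc_gt0 (prv u); rewrite prednK // ltnn IH //.
Qed.

Lemma nxtK v : vaddr v -> prv (nxt v) = v.
Proof.
elim: v => //= m u IH /andP[h hu]; case: ifP => //= h'; rewrite IH //.
by congr (_ :: _); lia.
Qed.

(* The darts (v, k) at v, in cyclic order: the children for k < nout v, then the
   right neighbour, the parent if v is a child, and the left neighbour for
   k = q - 1.  [opp_dart] reverses the edge. *)
Definition opp_dart (d : seq nat * nat) : seq nat * nat :=
  let: (v, k) := d in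
  if k < nout v then ((p - 2) * k :: v, q - 2) else
  if k == q - 1 then (prv v, nout (prv v)) else
  if k == nout v then (nxt v, q - 1) else
  (behead v, head 0 v %/ (p - 2)).

Definition vdart (d : seq nat * nat) : bool := vaddr d.1 && (d.2 < q).

Variant dart_spec (v : seq nat) (k : nat) : seq nat * nat -> Type :=
| DartOut of k < nout v : dart_spec v k ((p - 2) * k :: v, q - 2)
| DartPrv of k = q - 1 & v <> [::] & nout v <= k :
    dart_spec v k (prv v, nout (prv v))
| DartNxt of k = nout v & v <> [::] & k < q - 1 : dart_spec v k (nxt v, q - 1)
| DartPar m u of v = m :: u & k = q - 2 & p - 2 %| m & m < nsucc u :
    dart_spec v k (u, m %/ (p - 2)).

Lemma opp_dartP v k : vdart (v, k) -> dart_spec v k (opp_dart (v, k)).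
Proof.
rewrite /vdart /= => /andP[hv hk] /=; case: ltnP => h; first exact: DartOut.
have v0 : v <> [::] by move=> v0; move: h; rewrite v0 /=; lia.
case: eqP => [kq|kq]; first exact: DartPrv.
case: eqP => [kr|kr]; first by apply: DartNxt => //; lia.
case: v hv h v0 kr => // m u /= /andP[hm hu] h _ kr.
by apply: DartPar => //; move: h kr; case: ifP => // _; lia.
Qed.

Lemma vdart_opp d : vdart d -> vdart (opp_dart d).
Proof.
case: d => v k hd; case: (opp_dartP hd) (hd) => [h|kq v0 h|kr v0 h|m u -> kq hm hu];
  rewrite /vdart /= => /andP[hv hk].
- by rewrite nsucc_nout h hv; lia.
- rewrite vaddr_prv //=; have : prv v <> [::].
    by move=> e; apply: v0; move: (size_prv v); rewrite e; case: (v).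
  by case: (prv v) => // m u _; have := nout_cons m u; lia.
- by rewrite vaddr_nxt //=; lia.
- case/andP: hv => _ ->; have := div_nout hu; have := nout_le u; lia.
Qed.

Lemma nout_child k v : nout ((p - 2) * k :: v) = q - 3.
Proof. by rewrite /= dvdn_mulr. Qed.

Lemma opp_dartK d : vdart d -> opp_dart (opp_dart d) = d.
Proof.
case: d => v k hd; case: (opp_dartP hd) (hd) => [h|kq v0 h|kr v0 h|m u -> kq hm hu];
  rewrite /vdart /= => /andP[hv hk].
- rewrite dvdn_mulr //; case: ifP => ?; first lia.
  case: eqP => ?; first lia.
  case: eqP => ?; first lia.
  by rewrite mulKn //; lia.
- rewrite ltnn prvK // -kq; case: eqP => [e|_]; last by rewrite eqxx.
  exfalso; have : prv v <> [::].
    by move=> e'; apply: v0; move: (size_prv v); rewrite e'; case: (v).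
  by case: (prv v) e => // m u e _; have := nout_cons m u; lia.
- have : nxt v <> [::].
    by move=> e'; apply: v0; move: (size_nxt v); rewrite e'; case: (v).
  case E : (nxt v) => [//|m u] _; rewrite -E.
  have := nout_cons m u; rewrite -E => ?; case: ifP => [?|_]; first lia.
  by rewrite eqxx nxtK // kr.
- by rewrite div_nout // mulnC divnK // kq.
Qed.

(* (v, k, true) and (v, k, false) are the flags of the dart (v, k) in the face
   between it and the next, resp. the previous, dart at v. *)
Definition rflag := (seq nat * nat * bool)%type.

Definition vflag (x : rflag) : bool := vdart x.1.

Definition dsucc (k : nat) : nat := if k.+1 < q then k.+1 else 0.
Definition dpred (k : nat) : nat := if k is k'.+1 then k' else q.-1.

Lemma dsucc_lt k : dsucc k < q. Proof. by rewrite /dsucc; case: ifP; lia. Qed.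
Lemma dpred_lt k : k < q -> dpred k < q. Proof. by case: k => [|k] /=; lia. Qed.
Lemma dsuccK k : k < q -> dpred (dsucc k) = k.
Proof. by rewrite /dsucc; case: ifP => //=; lia. Qed.
Lemma dpredK k : k < q -> dsucc (dpred k) = k.
Proof. by rewrite /dsucc; case: k => [|k] /=; case: ifP => //=; lia. Qed.

(** [rs0] keeps the face while reversing the dart, which exchanges the two sides of the dart; hence
    the bit flips. *)
Definition rs0 (x : rflag) : rflag := (opp_dart x.1, ~~ x.2).
Definition rs1 (x : rflag) : rflag :=
  let: (v, k, b) := x in ((v, if b then dsucc k else dpred k), ~~ b).
Definition rs2 (x : rflag) : rflag := (x.1, ~~ x.2).

Lemma vflag0 x : vflag x -> vflag (rs0 x). Proof. exact: vdart_opp. Qed.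
Lemma vflag1 x : vflag x -> vflag (rs1 x).
Proof.
case: x => [[v k] b]; rewrite /vflag /vdart /= => /andP[-> h] /=.
by case: b; [exact: dsucc_lt | exact: dpred_lt].
Qed.
Lemma vflag2 x : vflag x -> vflag (rs2 x). Proof. by []. Qed.

Definition flag : Type := {x : rflag | vflag x}.

Definition fs0 (x : flag) : flag :=
  exist (fun x => vflag x) _ (vflag0 (svalP x)).
Definition fs1 (x : flag) : flag :=
  exist (fun x => vflag x) _ (vflag1 (svalP x)).
Definition fs2 (x : flag) : flag :=
  exist (fun x => vflag x) _ (vflag2 (svalP x)).

Definition fsw (i : 'I_3) : flag -> flag :=
  match val i with 0 => fs0 | 1 => fs1 | _ => fs2 end.

Lemma fs0K : involutive fs0.
Proof.
case=> -[[v k] b] h; apply: val_inj => /=.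
by rewrite /rs0 /= negbK (@opp_dartK (v, k)).
Qed.
Lemma fs1K : involutive fs1.
Proof.
case=> -[[v k] b] h; apply: val_inj => /=; rewrite negbK.
by move: h; rewrite /vflag /vdart /= => /andP[_ h]; case: b; rewrite (dsuccK, dpredK).
Qed.
Lemma fs2K : involutive fs2.
Proof. by case=> -[[v k] b] h; apply: val_inj => /=; rewrite /rs2 /= negbK. Qed.

Lemma fswK i : involutive (fsw i).
Proof.
by rewrite /fsw; case: (val i) => [|[|n]]; [exact: fs0K|exact: fs1K|exact: fs2K].
Qed.

Definition fside (x : flag) : bool := (val x).2.
(** The bit is a 2-colouring of the flag graph; it stands in for the determinant of a group element
    in the parity argument on distances. *)
Lemma fside_sw i x : fside (fsw i x) = ~~ fside x.
Proof. by rewrite /fsw; case: x => -[[v k] b] h; case: (val i) => [|[|n]]. Qed.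

Definition addr (x : flag) : seq nat := (val x).1.1.
Lemma addr_fs1 x : addr (fs1 x) = addr x.
Proof. by case: x => -[[v k] b] h. Qed.
Lemma addr_fs2 x : addr (fs2 x) = addr x.
Proof. by []. Qed.

Lemma fs02C x : fs0 (fs2 x) = fs2 (fs0 x).
Proof. by apply: val_inj. Qed.

Lemma vflag_mk v k b : vaddr v -> k < q -> vflag (v, k, b).
Proof. by rewrite /vflag /vdart /= => -> ->. Qed.

Definition mkf v k b (hv : vaddr v) (hk : k < q) : flag :=
  exist (fun x => vflag x) _ (vflag_mk b hv hk).

Lemma flagP (x : flag) : exists v k b (hv : vaddr v) (hk : k < q),
  x = mkf b hv hk.
Proof.
case: x => -[[v k] b] h; case/andP: (h) => hv hk.
by exists v, k, b, hv, hk; apply: val_inj.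
Qed.

Lemma vertex_rot (x : flag) : iter q (fun x => fs2 (fs1 x)) x = x.
Proof.
have H v k (hv : vaddr v) (hk : k < q) n : n <= q ->
    val (iter n (fun x => fs2 (fs1 x)) (mkf true hv hk)) =
    (v, (if k + n < q then k + n else k + n - q), true).
  elim: n => [|n IH] hn; first by rewrite /= addn0 hk.
  rewrite iterS; have := IH (ltnW hn).
  case: (iter n _ _) => y hy /= ->; rewrite /rs2 /dsucc /=.
  congr (_, _, _); rewrite addnS /dsucc; case: (ltnP (k + n) q) => h1; repeat (case: ifP => ?); try lia.
have H' v k (hv : vaddr v) (hk : k < q) n : n <= q ->
    val (iter n (fun x => fs2 (fs1 x)) (mkf false hv hk)) =
    (v, (if n <= k then k - n else k + q - n), false).
  elim: n => [|n IH] hn; first by rewrite /= subn0.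
  rewrite iterS; have := IH (ltnW hn).
  case: (iter n _ _) => y hy /= ->; congr (_, _, _).
  have -> a : dpred a = if a == 0 then q.-1 else a.-1 by case: a.
  by case: (leqP n k) => h1; repeat (case: ifP => ?); lia.
case: (flagP x) => v [k [[] [hv [hk ->]]]]; apply: val_inj.
  by rewrite H //=; case: ifP => h; congr (_, _, _); lia.
by rewrite H' //=; case: ifP => h; congr (_, _, _); lia.
Qed.

(** * Faces close up after p steps *)

Definition frho (x : flag) : flag := fs0 (fs1 x).

(** [frho] on the flags with bit true, seen on darts: turn to the next dart and traverse it. The top
    of a face is run from right to left. *)
Definition face_next (d : seq nat * nat) : seq nat * nat :=
  let: (v, k) := d in opp_dart (v, dsucc k).

Arguments opp_dart : simpl never.
Arguments face_next : simpl never.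

Lemma face_nextE v k : face_next (v, k) = opp_dart (v, dsucc k). Proof. by []. Qed.

Lemma dsucc_lt1 k : k < q.-1 -> dsucc k = k.+1.
Proof. by rewrite /dsucc; case: ifP; lia. Qed.

Lemma opp_last m v : opp_dart (m :: v, q - 1) = (prv (m :: v), nout (prv (m :: v))).
Proof.
rewrite /opp_dart; have := nout_cons m v; case: ifP => h1 h2; first lia.
by rewrite eqxx.
Qed.

Lemma opp_out v k : k < nout v -> opp_dart (v, k) = ((p - 2) * k :: v, q - 2).
Proof. by rewrite /opp_dart => ->. Qed.

Lemma opp_nxt m v : opp_dart (m :: v, nout (m :: v)) = (nxt (m :: v), q - 1).
Proof.
rewrite /opp_dart ltnn eqxx; case: ifP => // /eqP; have := nout_cons m v; lia.
Qed.

Lemma opp_par k v : opp_dart ((p - 2) * k :: v, q - 2) = (v, k).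
Proof.
rewrite /opp_dart nout_child; case: ifP => ?; first lia.
case: eqP => ?; first lia.
case: eqP => ?; first lia.
by rewrite /= mulKn //; lia.
Qed.

Lemma phi_par m v : face_next (m :: v, q - 2) = (prv (m :: v), nout (prv (m :: v))).
Proof. by rewrite face_nextE dsucc_lt1; [rewrite -opp_last; congr (opp_dart (_, _)) |]; lia. Qed.

(** From the vertex j places after child k, j steps lead left along the top of the face to that
    child, and one more step down to v. *)
Lemma phi_down k v j : j <= p - 3 ->
  iter j.+1 face_next ((p - 2) * k + j :: v, nout ((p - 2) * k + j :: v)) = (v, k).
Proof.
elim: j => [|j IH] hj.
  rewrite addn0 nout_child iterS [iter 0 _ _]/= face_nextE dsucc_lt1; last lia.
  by rewrite -[RHS]opp_par; congr (opp_dart (_, _)); lia.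
rewrite iterSr addnS; set m := ((p - 2) * k + j).+1.
have -> : nout (m :: v) = q - 2.
  rewrite /= /m -addnS dvdn_addr ?dvdn_mulr // gtnNdvd //; lia.
by rewrite phi_par [prv _]/= IH //; lia.
Qed.

Lemma phi_fan v k : k.+1 < nout v ->
  iter 2 face_next (v, k) = ((p - 2) * k + (p - 3) :: v, nout ((p - 2) * k + (p - 3) :: v)).
Proof.
move=> h; rewrite iterS [iter 1 _ _]/= (face_nextE v) dsucc_lt1; last by have := nout_le v; lia.
rewrite opp_out // phi_par.
case E : ((p - 2) * k.+1) => [|m]; first nia.
by rewrite [prv _]/=; have -> : m = (p - 2) * k + (p - 3) by nia.
Qed.

(** The last face at the root, between child q - 1 and child 0, where [prv] wraps around the
    level. *)
Lemma phi_fan0 : iter 2 face_next ([::], q - 1) =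
  ([:: (p - 2) * (q - 1) + (p - 3)], nout [:: (p - 2) * (q - 1) + (p - 3)]).
Proof.
rewrite iterS [iter 1 _ _]/= (face_nextE [::]) /dsucc; case: ifP => ?; first lia.
rewrite opp_out; last by rewrite /=; lia.
rewrite muln0 phi_par [prv _]/=.
by have -> : (q * (p - 2)).-1 = (p - 2) * (q - 1) + (p - 3) by nia.
Qed.

Lemma nsuccE v : v <> [::] -> nsucc v = (nout v * (p - 2)).-1.
Proof. by case: v. Qed.

Lemma nsucc_pred v : v <> [::] ->
  (nsucc v).-1 = (p - 2) * (nout v).-1 + (p - 4).
Proof.
move=> v0; have := nout_gt0 v; rewrite nsuccE //.
case: (nout v) => // n _; rewrite mulSn [n * _]mulnC succnK.
by move: ((p - 2) * n) => N; lia.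
Qed.

(** The face standing on the edge from v to its right neighbour: the three steps go along that edge,
    up to the first child of the neighbour, and left to the last vertex below v, which is p - 4
    places after the last child of v. *)
Lemma phi_edge v : v <> [::] -> vaddr v ->
  iter 3 face_next (v, (nout v).-1) =
  ((p - 2) * (nout v).-1 + (p - 4) :: v,
   nout ((p - 2) * (nout v).-1 + (p - 4) :: v)).
Proof.
move=> v0 hv; have h0 := nout_gt0 v; rewrite -nsucc_pred //.
have h1 : nout v <= q - 2 by case: (v) v0 => // m u _; exact: nout_cons.
have tn : opp_dart (v, nout v) = (nxt v, q - 1) by case: (v) v0 => // m u _; exact: opp_nxt.
rewrite !iterS [iter 0 _ _]/= (face_nextE v) dsucc_lt1; last lia.
rewrite prednK // tn face_nextE /dsucc; case: ifP => ?; first lia.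
rewrite opp_out ?nout_gt0 // muln0 phi_par.
by have -> : prv (0 :: nxt v) = (nsucc v).-1 :: v by rewrite /= nxtK.
Qed.

Lemma phi_bottom v k : vaddr v -> k < nout v -> iter p face_next (v, k) = (v, k).
Proof.
move=> hv hk; case: (ltnP k.+1 (nout v)) => h.
  have {1}-> : p = (p - 3).+1 + 2 by lia.
  by rewrite iterD phi_fan // phi_down.
case: v hv hk h => [|m u] hv hk h.
  have -> : k = q - 1 by move: hk h => /=; lia.
  have {1}-> : p = (p - 3).+1 + 2 by lia.
  by rewrite iterD phi_fan0 phi_down.
have -> : k = (nout (m :: u)).-1 by lia.
have {1}-> : p = (p - 4).+1 + 3 by lia.
by rewrite iterD phi_edge // phi_down //; lia.
Qed.

Lemma vdart_phi d : vdart d -> vdart (face_next d).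
Proof.
case: d => v k /andP[/= h1 h2]; rewrite face_nextE.
by apply: vdart_opp; rewrite /vdart /= h1 dsucc_lt.
Qed.

Lemma vdart_iter n d : vdart d -> vdart (iter n face_next d).
Proof. by move=> h; elim: n => //= n; exact: vdart_phi. Qed.

Lemma phi_inj d d' : vdart d -> vdart d' -> face_next d = face_next d' -> d = d'.
Proof.
case: d d' => [v k] [v' k'] /andP[/= hv hk] /andP[/= hv' hk'] /(congr1 opp_dart).
rewrite !face_nextE !opp_dartK /vdart /= ?hv ?hv' ?dsucc_lt // => -[-> e].
by rewrite -(dsuccK hk) e dsuccK.
Qed.

(** The period of a face is computed directly only at a bottom corner, just after a dart to a child.
    Every walk gets there by going left to a child and down, after one step up if it starts at the
    right end of a bottom edge. *)
Lemma phi_reach d : vdart d ->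
  exists n v k, [/\ iter n face_next d = (v, k), k < nout v & vaddr v].
Proof.
have down v : vaddr v -> v <> [::] -> exists n u k,
    [/\ iter n face_next (v, nout v) = (u, k), k < nout u & vaddr u].
  case: v => // m u /= /andP[hm hu] _.
  exists (m %% (p - 2)).+1, u, (m %/ (p - 2)); split=> //; last exact: div_nout.
  have h : m %% (p - 2) <= p - 3.
    have : m %% (p - 2) < p - 2 by rewrite ltn_mod; lia.
    lia.
  by rewrite -[RHS](phi_down _ _ h) mulnC -divn_eq.
have par m u : vaddr (m :: u) -> exists n v k,
    [/\ iter n face_next (m :: u, q - 2) = (v, k), k < nout v & vaddr v].
  move=> h; have h' := vaddr_prv h; have [|n [v [k [e h1 h2]]]] := down _ h'.
    by case: (m).
  by exists n.+1, v, k; rewrite iterSr phi_par.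
case: d => v k /andP[/= hv hk].
case: (ltnP k (nout v)) => h; first by exists 0, v, k.
case: v hv h => [|m u] hv h; first by move: h => /=; lia.
case: (eqVneq k (nout (m :: u))) => [->|h1]; first exact: down.
case: (eqVneq k (q - 2)) => [->|h2]; first exact: par.
have -> : k = q - 1 by move: h h1 h2 => /=; case: ifP; lia.
have h0 : vaddr (0 :: m :: u) by apply/andP; split; [exact: nsucc_gt0 | exact: hv].
have [n [v [k' [e h3 h4]]]] := par _ _ h0.
exists n.+1, v, k'; rewrite iterSr face_nextE /dsucc; case: ifP => ?; first lia.
by rewrite opp_out ?nout_gt0 // muln0.
Qed.

(** Injectivity of [face_next] carries the period found at a bottom corner back to d. *)
Lemma phi_order d : vdart d -> iter p face_next d = d.
Proof.
move=> hd; have [n [v [k [e hk hv]]]] := phi_reach hd.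
have: iter n face_next (iter p face_next d) = iter n face_next d.
  by rewrite -iterD addnC iterD e phi_bottom.
have := vdart_iter p hd; move: (iter p face_next d) => d' hd'.
elim: n {e} => //= n IH /phi_inj e; apply: IH; apply: e; exact: vdart_iter.
Qed.

Lemma iter_frhoT n d (h : vflag (d, true)) :
  val (iter n frho (exist (fun x => vflag x) _ h)) = (iter n face_next d, true).
Proof.
elim: n => //= n; case: (iter n frho _) => y hy /= ->.
by case: (iter n face_next d).
Qed.

Lemma fs1_frho n x : iter n frho (fs1 (iter n frho x)) = fs1 x.
Proof.
have e z : frho (fs1 (frho z)) = fs1 z by rewrite /frho fs1K fs0K.
by elim: n x => // n IH x; rewrite iterSr iterS e IH.
Qed.

Lemma face_rot x : iter p frho x = x.
Proof.
have T y : fside y -> iter p frho y = y.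
  case: y => [[d []] hy] // _.
  by apply: val_inj; rewrite iter_frhoT /= phi_order.
case E : (fside x); first exact: T.
(* [fs1] exchanges the two values of the bit and reverses the walk, so the period is the same. *)
rewrite -[x in LHS]fs1K; set y := fs1 x.
have hy : fside y by move: E; rewrite /y; case: (x) => -[[v k] []].
by rewrite -[in LHS](T y hy) fs1_frho /y fs1K.
Qed.

(** * Connectedness of the flag graph *)

Lemma addr_ind (Q : flag -> Prop) x :
  (forall y, Q y -> Q (fs1 y)) -> (forall y, Q y -> Q (fs2 y)) -> Q x ->
  forall y, addr y = addr x -> Q y.
Proof.
move=> Q1s Q2s.
have side z : Q z -> forall y, (val y).1 = (val z).1 -> Q y.
  move=> hz y e; case: (eqVneq (val y).2 (val z).2) => e2.
    by rewrite (_ : y = z) //; apply: val_inj; case: (val z) (val y) e e2 =>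
      [? ?] [? ?] /= -> ->.
  rewrite (_ : y = fs2 z); first exact: Q2s.
  apply: val_inj; rewrite -[val (fs2 z)]/(rs2 (val z)) /rs2.
  case: (val z) (val y) e e2 => [d b] [d' c] /= ->.
  by case: b; case: c.
have step v k (hv : vaddr v) (hk : k < q) (hk' : dsucc k < q) b :
    Q (mkf b hv hk) -> Q (mkf b hv hk').
  move=> h; apply: (side (fs1 (mkf true hv hk))) => //.
  by apply: Q1s; apply: side h _ _.
have up v k n (hv : vaddr v) (hk : k < q) (hk' : k + n < q) b :
    Q (mkf b hv hk) -> Q (mkf b hv hk').
  elim: n hk' => [|n IH] hk' h; first by apply: side h _ _; rewrite /= addn0.
  have hk1 : k + n < q by lia.
  apply: (side _ (step _ _ hv hk1 (dsucc_lt _) b (IH hk1 h))) => //=.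
  by rewrite dsucc_lt1; [congr (_, _)|]; lia.
case: (flagP x) => v [k [b [hv [hk ->]]]] h y.
case: (flagP y) => v' [k' [b' [hv' [hk' ->]]]] /= e.
have q0 : 0 < q by lia.
have q1 : k + (q - 1 - k) < q by lia.
have h1 := step _ _ _ _ (dsucc_lt _) _ (up _ _ _ _ _ q1 _ h).
have h2 : Q (mkf b hv q0).
  by apply: side h1 _ _; rewrite /= /dsucc; case: ifP => //; lia.
have h3 := up v 0 k' hv q0 (hk' : 0 + k' < q) b h2.
by apply: side h3 _ _; rewrite /=; congr (_, _).
Qed.

Lemma fsw_ind_root (Q : flag -> Prop) x0 : addr x0 = [::] ->
  (forall i x, Q x -> Q (fsw i x)) -> Q x0 -> forall x, Q x.
Proof.
move=> ex0 Qs Q0.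
have Q0s := Qs ord0; have Q1s := Qs (lift ord0 ord0).
have Q2s := Qs ord_max; rewrite /fsw /= in Q0s Q1s Q2s.
have around x : Q x -> forall y, addr y = addr x -> Q y.
  by move=> h; apply: addr_ind.
have oppQ v k v' k' : vdart (v, k) -> (forall x, addr x = v -> Q x) ->
    opp_dart (v, k) = (v', k') -> forall x, addr x = v' -> Q x.
  move=> hd Qv e x ex; have hf : vflag (v, k, true) by [].
  have := Q0s _ (Qv (exist (fun x => vflag x) _ hf) erefl).
  by move/around; apply; rewrite ex /addr /= e.
have Qv v : vaddr v -> forall x, addr x = v -> Q x.
  elim: v => [|m u IH] hv; first by move=> x ex; apply: around Q0 _ _; rewrite ex.
  have hu : vaddr u by case/andP: hv.
  elim: m hv => [|m IHm] hv.
    rewrite -[0](muln0 (p - 2)).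
    apply: (oppQ u 0 _ _ _ (IH hu) (opp_out (nout_gt0 u))).
    by rewrite /vdart /= hu; lia.
  have hm : m.+1 < nsucc u by case/andP: hv.
  case: (boolP (p - 2 %| m.+1)) => hd.
    apply: (oppQ u (m.+1 %/ (p - 2)) _ (q - 2) _ (IH hu)).
      by rewrite /vdart /= hu (leq_trans (div_nout hm)) ?nout_le.
    by rewrite opp_out ?div_nout // mulnC divnK.
  have hv' : vaddr (m :: u) by rewrite /= hu (ltnW hm).
  have := oppQ _ _ _ _ _ (IHm hv') (opp_nxt m u); rewrite [nxt _]/= hm; apply.
  by apply/andP; split; [exact: hv' | apply: leq_ltn_trans (nout_cons m u) _; lia].
by move=> x; apply: (Qv (addr x)) => //; case: (flagP x) => v [k [b [hv [hk ->]]]].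
Qed.

(** Since the generators are involutions, the predicate [Q x -> Q r] is closed under them as well;
    it brings Q from x0 to the root flag, where [fsw_ind_root] applies. *)
Lemma fsw_ind (Q : flag -> Prop) x0 :
  (forall i x, Q x -> Q (fsw i x)) -> Q x0 -> forall x, Q x.
Proof.
move=> Qs Q0; have q0 : 0 < q by lia.
pose r : flag := mkf true (isT : vaddr [::]) q0.
have Qr : Q r.
  apply: (@fsw_ind_root (fun x => Q x -> Q r) r) Q0 => // i x h.
  by move/(Qs i); rewrite fswK.
by apply: (@fsw_ind_root Q r).
Qed.

(** * Levels of faces *)

(** The corner after dart k lies on the inner side of the level: it is bounded by level edges or the
    edge to the parent, and its face has its bottom one level lower. *)
Definition inner (v : seq nat) (k : nat) : bool := nout v <= k < q - 1.

(* The lowest level of a vertex of the face of x. *)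
Definition flevel (x : flag) : nat :=
  let: (v, k, b) := val x in size v - inner v (if b then k else dpred k).

Lemma flevel_fs1 x : flevel (fs1 x) = flevel x.
Proof.
case: (flagP x) => v [k [[] [hv [hk ->]]]]; rewrite /flevel /=.
  by rewrite dsuccK.
by [].
Qed.

Lemma flevel_fs0 x : flevel (fs0 x) = flevel x.
Proof.
suff T y : fside y -> flevel (fs0 y) = flevel y.
  case E : (fside x); first exact: T.
  have := T (fs0 x); rewrite fs0K => -> //; move: E.
  by case: (x) => -[[v k] []].
case: (flagP y) => v [k [[] [hv [hk ->]]]] // _; rewrite /flevel /= /rs0 /=.
have hd : vdart (v, k) by rewrite /vdart /= hv.
case: (opp_dartP hd) => [h|kq v0 h|kr v0 h|m u ev kq hm hu] /=.
- rewrite /inner nout_child; have -> : dpred (q - 2) = q - 3 by case E : (q - 2) => [|a] /=; lia.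
  have -> : q - 3 <= q - 3 < q - 1 by lia.
  by rewrite leqNgt h /= subn1 subn0.
- have h0 := nout_gt0 (prv v); rewrite size_prv /inner.
  have -> : (k < q - 1) = false by lia.
  rewrite andbF; have -> : nout (prv v) <= dpred (nout (prv v)) = false; last by [].
  by case: (nout (prv v)) h0 => //= n _; lia.
- rewrite size_nxt /inner; have -> : dpred (q - 1) = q - 2 by case E : (q - 1) => [|a] /=; lia.
  have -> : nout (nxt v) <= q - 2.
    case E : (nxt v) => [|m u]; last exact: nout_cons.
    by exfalso; apply: v0; move: (size_nxt v); rewrite E; case: (v).
  have -> : q - 2 < q - 1 by lia.
  by rewrite kr leqnn -kr h.
- rewrite ev /=; have -> : inner (m :: u) k = true.
    by rewrite /inner kq nout_cons; lia.
  have -> : inner u (dpred (m %/ (p - 2))) = false; last by rewrite subn0 subn1.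
  have := div_nout hu; rewrite /inner; case: (m %/ (p - 2)) => [|n] /= h.
    by rewrite subn1 ltnn andbF.
  by rewrite leqNgt (ltnW h).
Qed.

(** A face touches only two consecutive levels; this is what reduces belts to arithmetic on
    [flevel]. *)
Lemma size_addr x : flevel x <= size (addr x) <= (flevel x).+1.
Proof.
by case: (flagP x) => v [k [b [hv [hk ->]]]]; rewrite /flevel /addr /=;
  case: (inner _ _) => /=; lia.
Qed.

Lemma outer_face x : exists2 y, addr y = addr x & flevel y = size (addr x).
Proof.
case: (flagP x) => v [k [b [hv [hk ->]]]]; have q0 : 0 < q by lia.
exists (mkf true hv q0) => //.
by rewrite /flevel /= /inner leqNgt nout_gt0 subn0.
Qed.

Lemma inner_face x : addr x <> [::] ->
  exists2 y, addr y = addr x & (flevel y).+1 = size (addr x).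
Proof.
case: (flagP x) => v [k [b [hv [hk ->]]]]; rewrite /addr /= => v0.
have h : nout v < q - 1.
  by case: (v) v0 => // m u _; have := nout_cons m u; lia.
have hk' : nout v < q by lia.
exists (mkf true hv hk') => //.
by rewrite /flevel /= /inner leqnn h subn1 prednK //; case: (v) v0.
Qed.

Lemma bottom_vertex x : exists n, size (addr (iter n frho x)) = flevel x.
Proof.
have T y : fside y -> exists n, size (addr (iter n frho y)) = flevel y.
  case: (flagP y) => v [k [[] [hv [hk ->]]]] // _.
  have hd : vdart (v, k) by apply/andP.
  have [n [u [j [e h hu]]]] := phi_reach hd; exists n.
  have <- : flevel (iter n frho (mkf true hv hk)) = flevel (mkf true hv hk).
    by elim: n {e} => [|n IH] //; rewrite iterS flevel_fs0 flevel_fs1.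
  have ev : val (iter n frho (mkf true hv hk)) = (u, j, true).
    by rewrite /mkf iter_frhoT e.
  by rewrite /flevel /addr ev /= /inner leqNgt h subn0.
case E : (fside x); first exact: T.
have hy : fside (fs1 x) by move: E; case: (x) => -[[v k] []].
(* By [fs1_frho], x lies n steps after [fs1 z]; the remaining n * p - n steps complete n full turns
   and return to [fs1 z]. *)
have [n] := T _ hy; rewrite flevel_fs1 => <-; exists (n * p - n).
set z := iter n frho (fs1 x); rewrite -(addr_fs1 z); congr (size (addr _)).
have np : n <= n * p by case: (p) hp => // p' _; rewrite mulnS leq_addr.
rewrite -[x in LHS]fs1K -(fs1_frho n) -/z -iterD subnK //.
by elim: (n) => // n' IH; rewrite mulSn iterD IH face_rot.
Qed.

End Map.

Arguments opp_dart : simpl never.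
Arguments face_next : simpl never.

(** * Counting addresses by type *)

Section Enumeration.
Local Open Scope nat_scope.
Variables p q : nat.
Hypotheses (hp : 3 < p) (hq : 3 < q).

Local Notation nsucc := (nsucc p q).
Local Notation nout := (nout p q).
Local Notation is_child := (is_child p).
Local Notation vaddr := (vaddr p q).

Fixpoint addrs (i : nat) : seq (seq nat) :=
  if i is i'.+1 then [seq m :: u | u <- addrs i', m <- iota 0 (nsucc u)]
  else [:: [::]].

Lemma mem_addrs i v : (v \in addrs i) = vaddr v && (size v == i).
Proof.
elim: i v => [|i IH] v; first by rewrite inE; case: v => //= m u; rewrite andbF.
apply/allpairsPdep/idP => [[u [m [hu hm ->]]]|].
  move: hu hm; rewrite IH mem_iota add0n /= => /andP[-> /eqP ->] ->.
  by rewrite eqxx.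
case: v => [|m u] //= /andP[/andP[hm hu] /eqP[su]].
by exists u, m; rewrite IH hu su eqxx mem_iota add0n hm.
Qed.

Lemma uniq_addrs i : uniq (addrs i).
Proof.
elim: i => // i IH; apply: allpairs_uniq_dep => //.
  by move=> u _; exact: iota_uniq.
by move=> [u m] [u' m'] _ _ /= [-> ->].
Qed.

Lemma count_dvdn d k : 1 < d -> count (fun m => d %| m) (iota 0 (k * d)) = k.
Proof.
move=> hd; elim: k => // k IH.
rewrite mulSnr iotaD count_cat IH add0n.
case: d hd {IH} => // d hd; rewrite /= dvdn_mull // (@eq_in_count _ _ pred0).
  by rewrite count_pred0; lia.
move=> m; rewrite mem_iota => /andP[h1 h2] /=; apply/negbTE/negP => /dvdnP[j ej].
have : k < j by rewrite -(ltn_pmul2r (ltn0Sn d)) -ej.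
have : j < k.+1 by rewrite -(ltn_pmul2r (ltn0Sn d)) -ej mulSn; lia.
lia.
Qed.

(** Off the root the range stops one short of [nout u] full blocks; the omitted index is -1 modulo p
    - 2, hence not a child. *)
Lemma count_children u : count is_child [seq m :: u | m <- iota 0 (nsucc u)] = nout u.
Proof.
rewrite count_map; case: u => [|m u]; first by apply: count_dvdn; lia.
have h0 := nout_gt0 hp hq (m :: u).
rewrite nsuccE //; move: (nout _) h0 => k k0.
set n := (k * (p - 2)).-1; have en : k * (p - 2) = n + 1 by rewrite /n; nia.
have d1 : 1 < p - 2 by lia.
have h := count_dvdn k d1; rewrite en iotaD count_cat add0n /= addn0 in h.
rewrite -[RHS]h; suff -> : p - 2 %| n = false by rewrite addn0; apply: eq_count.
apply/negP => hd; have : p - 2 %| 1; last by rewrite dvdn1; lia.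
by rewrite -(dvdn_addr 1 hd) -en dvdn_mull.
Qed.

Definition nA i := count is_child (addrs i).
Definition nB i := count (predC is_child) (addrs i).

Lemma nAB i : nA i + nB i = size (addrs i).
Proof. exact: count_predC. Qed.

Lemma sum_addrs (f : seq nat -> nat) (x y : nat) (i : nat) :
  (forall m u, f (m :: u) = if is_child (m :: u) then x else y) ->
  sumn [seq f u | u <- addrs i.+1] = x * nA i.+1 + y * nB i.+1.
Proof.
move=> hf; rewrite /nA /nB.
have : forall v, v \in addrs i.+1 -> v != [::].
  by move=> v; rewrite mem_addrs; case: v => //=; rewrite andbF.
elim: (addrs _) => [|v s IH] h; first by rewrite !muln0.
have hv := h v (mem_head _ _).
rewrite [map _ _]/= [sumn _]/= IH; last by move=> w hw; apply: h; rewrite inE hw orbT.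
have cc (a : pred (seq nat)) : count a (v :: s) = a v + count a s by [].
case: v hv cc {h} => // m u _ cc; rewrite hf !cc.
rewrite -[predC _ _]/(~~ is_child (m :: u)); move: (is_child (m :: u)) => b.
by rewrite !mulnDr; case: b; rewrite /= ?muln1 ?muln0; lia.
Qed.

Lemma nA_rec i : nA i.+2 = (q - 3) * nA i.+1 + (q - 2) * nB i.+1.
Proof.
rewrite -(sum_addrs (f := nout)) // {1}/nA [addrs i.+2]/= count_flatten -map_comp.
by congr sumn; apply: eq_map => u /=; rewrite count_children.
Qed.

Lemma nAB_rec i : nA i.+2 + nB i.+2 =
  ((q - 3) * (p - 2)).-1 * nA i.+1 + ((q - 2) * (p - 2)).-1 * nB i.+1.
Proof.
rewrite nAB -(sum_addrs (f := nsucc)); last first.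
  by move=> m u /=; case: (p - 2 %| m).
rewrite [addrs i.+2]/= size_flatten /shape -map_comp.
by congr sumn; apply: eq_map => u /=; rewrite size_map size_iota.
Qed.

Lemma nB_rec i : nB i.+2 =
  ((q - 3) * (p - 3)).-1 * nA i.+1 + ((q - 2) * (p - 3)).-1 * nB i.+1.
Proof.
have := nAB_rec i; rewrite nA_rec.
have e k : 0 < k -> (k * (p - 2)).-1 = (k * (p - 3)).-1 + k.
  move=> k0; have h : 0 < k * (p - 3) by rewrite muln_gt0 k0; lia.
  have -> : k * (p - 2) = k * (p - 3) + k by rewrite -mulnSr; congr (_ * _); lia.
  by move: (k * (p - 3)) h => x; lia.
rewrite !e; [|lia|lia].
move: ((q - 3) * (p - 3)).-1 ((q - 2) * (p - 3)).-1 => x y; nia.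
Qed.

Lemma nA1 : nA 1 = q.
Proof. by rewrite /nA /= cats0 count_children. Qed.

Lemma nAB1 : nA 1 + nB 1 = q * (p - 2).
Proof. by rewrite nAB /= cats0 size_map size_iota. Qed.

Lemma nAB_gt0 i : 0 < nA i.+1 /\ 0 < nB i.+1.
Proof.
elim: i => [|i [IHa IHb]]; first by rewrite nA1; have := nAB1; rewrite nA1; nia.
rewrite nA_rec nB_rec; split; first by nia.
have : 0 < ((q - 2) * (p - 3)).-1 by nia.
by move: (((q - 2) * (p - 3)).-1) (((q - 3) * (p - 3)).-1) => x y; nia.
Qed.

(* The transition matrix of (nA, nB) has determinant 1, and c is its trace. *)
Lemma nA_rec2 i : nA i.+3 + nA i.+1 = ((p - 2) * (q - 2) - 2) * nA i.+2.
Proof.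
rewrite nA_rec nB_rec !nA_rec.
have [s es] : exists s, p = s + 4 by exists (p - 4); lia.
have [t et] : exists t, q = t + 4 by exists (q - 4); lia.
move: (nA i.+1) (nB i.+1) => a b; rewrite es et.
have -> : t + 4 - 3 = t + 1 by lia.
have -> : t + 4 - 2 = t + 2 by lia.
have -> : s + 4 - 3 = s + 1 by lia.
have -> : s + 4 - 2 = s + 2 by lia.
have -> : ((t + 1) * (s + 1)).-1 = t * s + t + s by nia.
have -> : ((t + 2) * (s + 1)).-1 = t * s + t + 2 * s + 1 by nia.
have -> : (s + 2) * (t + 2) - 2 = s * t + 2 * s + 2 * t + 2 by nia.
nia.
Qed.

Lemma nB_rec2 i : nB i.+3 + nB i.+1 = ((p - 2) * (q - 2) - 2) * nB i.+2.
Proof.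
rewrite nB_rec nA_rec !nB_rec.
have [s es] : exists s, p = s + 4 by exists (p - 4); lia.
have [t et] : exists t, q = t + 4 by exists (q - 4); lia.
move: (nA i.+1) (nB i.+1) => a b; rewrite es et.
have -> : t + 4 - 3 = t + 1 by lia.
have -> : t + 4 - 2 = t + 2 by lia.
have -> : s + 4 - 3 = s + 1 by lia.
have -> : s + 4 - 2 = s + 2 by lia.
have -> : ((t + 1) * (s + 1)).-1 = t * s + t + s by nia.
have -> : ((t + 2) * (s + 1)).-1 = t * s + t + 2 * s + 1 by nia.
have -> : (s + 2) * (t + 2) - 2 = s * t + 2 * s + 2 * t + 2 by nia.
nia.
Qed.

Local Notation s0 := (fs0 hp hq).

Lemma edge_up x : size (addr (s0 x)) = (size (addr x)).+1 ->
  exists2 k, k < nout (addr x) & addr (s0 x) = (p - 2) * k :: addr x.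
Proof.
case: (flagP x) => v [k [b [hv [hk ->]]]]; rewrite /addr /=.
have hd : vdart p q (v, k) by apply/andP.
case: (opp_dartP hp hq hd) => [h|kq v0 h|kr v0 h|m u -> kq hm hu] /=.
- by exists k.
- by rewrite size_prv; lia.
- by rewrite size_nxt; lia.
- by lia.
Qed.

Lemma edge_down v k : vaddr v -> k < nout v ->
  exists2 x : flag p q, addr x = v & addr (s0 x) = (p - 2) * k :: v.
Proof.
move=> hv hk; have hk' := leq_trans hk (nout_le hp hq v).
by exists (mkf true hv hk') => //; rewrite /addr /= opp_out.
Qed.

End Enumeration.

(** * Chambers of a rank 3 reflection group *)

Section Tits.
Variables (R : realFieldType) (V : lmodType R) (X : Type).
Variables (sw : 'I_3 -> X -> X) (side : X -> bool) (root : X -> 'I_3 -> V).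
Variables (K : 'I_3 -> 'I_3 -> R) (m : 'I_3 -> 'I_3 -> nat).
Hypothesis swK : forall i, involutive (sw i).
Hypothesis side_sw : forall i x, side (sw i x) = ~~ side x.
Hypothesis sw_ind : forall (Q : X -> Prop) b,
  (forall i x, Q x -> Q (sw i x)) -> Q b -> forall x, Q x.
Hypothesis m_gt0 : forall i j, i != j -> (0 < m i j)%N.
Hypothesis sw_order : forall i j, i != j ->
  forall x, iter (m i j) (fun x => sw j (sw i x)) x = x.
Hypothesis root_sw : forall i x j,
  root (sw i x) j = root x j - (2 * K j i) *: root x i.
Hypothesis K1 : forall i, K i i = 1.
Hypothesis K_sym : forall i j, K i j = K j i.
(** All that is asked of the angle between two walls: Chebyshev numbers that stay nonnegative for m
    steps. In the application [K i j] is - cos (pi / m). *)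
Hypothesis cheb : forall i j, i != j -> exists u : nat -> R,
  [/\ u 0%N = 0, u 1%N = 1, forall n, u n.+2 = - (2 * K i j) * u n.+1 - u n
    & forall n, (n <= m i j)%N -> 0 <= u n].

Fixpoint alt (i j : 'I_3) (n : nat) (x : X) : X :=
  if n is n'.+1 then alt j i n' (sw i x) else x.

Definition alt_letter (i j : 'I_3) (n : nat) : 'I_3 := if odd n then j else i.

Lemma altS i j n x : alt i j n.+1 x = sw (alt_letter i j n) (alt i j n x).
Proof.
elim: n i j x => // n IH i j x.
by rewrite -[LHS]/(alt j i n.+1 (sw i x)) IH /alt_letter /=; case: (odd n).
Qed.

Lemma alt_double i j n x :
  alt i j n.*2 x = iter n (fun x => sw j (sw i x)) x.
Proof. by elim: n x => // n IH x; rewrite doubleS iterSr -IH. Qed.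

(** The alternating path in i and j closes after 2 m steps, so a steps one way end where 2 m - a
    steps the other way do. *)
Lemma alt_rev i j a b x : i != j -> (a + b = (m i j).*2)%N ->
  alt i j a x = alt j i b x.
Proof.
move=> ij; elim: b a => [|b IH] a e.
  by rewrite addn0 in e; rewrite e alt_double sw_order.
have e' : (a.+1 + b = (m i j).*2)%N by rewrite addSnnS.
rewrite altS -(IH _ e') altS /alt_letter.
suff -> : odd a = ~~ odd b by case: (odd b); rewrite swK.
by have := congr1 odd e'; rewrite odd_double oddD /=; case: (odd a); case: (odd b).
Qed.

Lemma braid i j x : i != j -> alt i j (m i j) x = alt j i (m i j) x.
Proof. by move=> ij; apply: alt_rev => //; rewrite addnn. Qed.

Variable b : X.

Inductive reach : nat -> X -> Prop :=
| reach0 : reach 0 b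
| reachS n i x : reach n x -> reach n.+1 (sw i x).

Lemma reach_ex x : exists n, `[< reach n x >].
Proof.
apply: (@sw_ind (fun x => exists n, `[< reach n x >]) b).
  by move=> i y [n /asboolP h]; exists n.+1; apply/asboolP; apply: reachS.
by exists 0%N; apply/asboolP; apply: reach0.
Qed.

Definition len (x : X) : nat := ex_minn (reach_ex x).

Lemma len_reach x : reach (len x) x.
Proof. by rewrite /len; case: ex_minnP => n /asboolP. Qed.

Lemma len_le x n : reach n x -> (len x <= n)%N.
Proof. by move=> h; rewrite /len; case: ex_minnP => k _; apply; apply/asboolP. Qed.

Lemma reach_side n x : reach n x -> odd n = side b (+) side x.
Proof.
by elim => [|k i y _ /= ->]; rewrite ?addbb // side_sw; case: (side _); case: (side _).
Qed.

Lemma len_sw_le i x : (len (sw i x) <= (len x).+1)%N.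
Proof. by apply: len_le; apply: reachS; apply: len_reach. Qed.

(** Neighbouring distances differ by at most one, and [side] records their parity, so they cannot be
    equal. *)
Lemma len_sw i x : len (sw i x) = (len x).+1 \/ len x = (len (sw i x)).+1.
Proof.
have h1 := len_sw_le i x; have h2 := len_sw_le i (sw i x); rewrite swK in h2.
have := reach_side (len_reach x); have := reach_side (len_reach (sw i x)).
rewrite side_sw; case: (eqVneq (len x) (len (sw i x))) => [->|]; last by lia.
by move=> ->; case: (side b); case: (side x).
Qed.

Lemma len_eq0 x : len x = 0%N -> x = b.
Proof. by move=> h; have r := len_reach x; rewrite h in r; inversion r. Qed.

Lemma len_descent x : (0 < len x)%N -> exists t, len x = (len (sw t x)).+1.
Proof.
suff H n : reach n x -> n = len x -> (0 < n)%N -> exists t, len x = (len (sw t x)).+1.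
  exact: (H _ (len_reach x)).
case=> // k i y r e _; exists i; rewrite swK -e; congr _.+1.
apply/eqP; rewrite eqn_leq (len_le r) andbT -ltnS e.
exact: len_sw_le.
Qed.

Definition nonneg (v : V) : Prop :=
  exists2 c : 'I_3 -> R, (forall j, 0 <= c j) & v = \sum_j c j *: root b j.

Lemma nonneg_comb u v (x y : R) : nonneg u -> nonneg v -> 0 <= x -> 0 <= y ->
  nonneg (x *: u + y *: v).
Proof.
move=> [c hc ->] [d hd ->] hx hy; exists (fun j => x * c j + y * d j) => [j|].
  by rewrite addr_ge0 ?mulr_ge0.
rewrite !scaler_sumr -big_split /=; apply: eq_bigr => j _.
by rewrite scalerDl !scalerA.
Qed.

(* u_n = sin (n pi / m) / sin (pi / m) *)
Lemma alt_root s t (u : nat -> R) k x : s != t ->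
  u 0%N = 0 -> u 1%N = 1 -> (forall n, u n.+2 = - (2 * K t s) * u n.+1 - u n) ->
  let y := alt t s k.+1 x in
  exists f g : V, [/\ (f = root y s /\ g = root y t) \/ (f = root y t /\ g = root y s),
    root x t = - (u k.+1 *: f + u k *: g)
    & root x s = u k.+2 *: f + u k.+1 *: g].
Proof.
move=> st u0 u1 uS /=.
have e1 z t' : root z t' = - root (sw t' z) t'.
  by rewrite -{1}(swK t' z) root_sw K1 mulr1 scaler_nat mulr2n opprD addrA subrr sub0r.
have e2 z s' t' : root z s' = root (sw t' z) s' - (2 * K s' t') *: root (sw t' z) t'.
  by rewrite -{1}(swK t' z) root_sw.
elim: k s t x st uS => [|k IH] s t x st uS.
  exists (root (sw t x) t), (root (sw t x) s); split; first by right.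
    by rewrite e1 u1 u0 scale1r scale0r addr0.
  by rewrite (e2 x s t) uS u1 u0 subr0 mulr1 scale1r scaleNr addrC K_sym.
have [||f [g [fg h1 h2]]] := IH t s (sw t x).
- by rewrite eq_sym.
- by move=> n; rewrite K_sym.
exists f, g; split; first by case: fg => -[-> ->]; [right|left].
  by rewrite e1 h2.
rewrite (e2 x s t) h1 h2 scalerDr !scalerA opprD (uS k.+1) K_sym.
rewrite opprD addrACA -!(scaleNr _ f) -!(scaleNr _ g) -!scalerDl.
congr (_ *: _ + _ *: _); first by ring.
by rewrite uS; ring.
Qed.

Lemma len_alt i j k x : (len x <= len (alt i j k x) + k)%N.
Proof.
elim: k i j x => [|k IH] i j x; first by rewrite addn0.
by have := IH j i (sw i x); have := len_sw_le i (sw i x); rewrite swK /=; lia.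
Qed.

(* Descend from x alternately along t and s for as long as the distance to b
   drops: this stops in fewer than m steps, at a flag from which both s and t
   lead away from b. *)
Lemma root_pos x s : len (sw s x) = (len x).+1 -> nonneg (root x s).
Proof.
have [n] := ubnP (len x); elim: n x s => // n IH x s hn hs.
have [h0|h0] := posnP (len x).
  rewrite (len_eq0 h0); exists (fun j => (j == s)%:R) => [j|]; first by case: eqP.
  rewrite (bigD1 s) //= eqxx scale1r big1 ?addr0 // => j /negPf ->.
  by rewrite scale0r.
have [t ht] := len_descent h0.
have ts : t != s by apply/eqP => ets; move: ht hs; rewrite ets; lia.
pose P k := (len (alt t s k x) + k != len x)%N.
(* The descent cannot last m steps: by the braid relation the same end is reached by starting with
   s, which leads away from b, and the m - 1 steps left cannot make up for that. *)
have exP : exists k, P k.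
  exists (m t s); rewrite /P braid //; case E : (m t s) (m_gt0 ts) => [|m'] // _.
  by rewrite [alt _ _ _ _]/=; have := len_alt t s m' (sw s x); lia.
case: (ex_minnP exP) => k0 hk0 mink0.
have le_m : (k0 <= m t s)%N.
  apply: mink0; rewrite /P braid //; case E : (m t s) (m_gt0 ts) => [|m'] // _.
  by rewrite [alt _ _ _ _]/=; have := len_alt t s m' (sw s x); lia.
case: k0 hk0 mink0 le_m => [|[|k]]; first by rewrite /P /= addn0 eqxx.
  by rewrite /P /= ht addn1 eqxx.
move=> hk0 mink0 le_m; pose y := alt t s k.+1 x.
have dec j : (j < k.+2)%N -> (len (alt t s j x) + j = len x)%N.
  by move=> hj; apply/eqP; apply: contraTT hj => hj; rewrite -leqNgt mink0.
have hy : (len y + k.+1 = len x)%N by exact: dec.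
(* One of the two letters continues the path, where the descent stops by minimality; the other
   undoes the last descending step. *)
have up l : l = s \/ l = t -> len (sw l y) = (len y).+1.
  have up1 : len (sw (alt_letter t s k.+1) y) = (len y).+1.
    case: (len_sw (alt_letter t s k.+1) y) => // h.
    by move: hk0; rewrite /P altS -/y; lia.
  have up2 : len (sw (alt_letter t s k) y) = (len y).+1.
    have -> : sw (alt_letter t s k) y = alt t s k x by rewrite /y altS swK.
    by have := dec k (leqnSn _); lia.
  by move: up1 up2; rewrite /alt_letter /=; case: (odd k) => ? ? [] ->.
have [u [u0 u1 uS u_ge0]] := cheb ts.
have st : s != t by rewrite eq_sym.
have [f [g [fg _ ->]]] := alt_root k x st u0 u1 uS.
have [nf ng] : nonneg f /\ nonneg g.
  have ns : nonneg (root y s) by apply: IH; [lia | apply: up; left].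
  have nt : nonneg (root y t) by apply: IH; [lia | apply: up; right].
  by case: fg => -[-> ->].
by apply: nonneg_comb => //; apply: u_ge0; lia.
Qed.

Lemma root_neg x s : len x = (len (sw s x)).+1 -> nonneg (- root x s).
Proof.
move=> h; have -> : - root x s = root (sw s x) s.
  by rewrite root_sw K1 mulr1 scaler_nat mulr2n opprD addrA subrr sub0r.
by apply: root_pos; rewrite swK.
Qed.

Lemma root_sign x s : nonneg (root x s) \/ nonneg (- root x s).
Proof. by case: (len_sw s x) => h; [left; apply: root_pos | right; apply: root_neg]. Qed.

(* A functional on V plays the part of a point: [L (root x i)] are its
   coordinates in the chamber of x. *)
Lemma chamber_unique (L : V -> R) (x : X) :
  (forall u v, L (u + v) = L u + L v) -> (forall a u, L (a *: u) = a * L u) ->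
  (forall i, 0 <= L (root b i)) -> (forall i, 0 <= L (root x i)) ->
  (forall i, L (root x i) = L (root b i)) /\
  forall (T : Type) (f : X -> T),
    (forall i y, L (root b i) = 0 -> f (sw i y) = f y) -> f x = f b.
Proof.
move=> LD LZ; have [n] := ubnP (len x); elim: n x => // n IH x hn hb hx.
have [h0|h0] := posnP (len x); first by rewrite (len_eq0 h0).
have [s hs] := len_descent h0.
have L0 : L 0 = 0 by rewrite -[0](scale0r 0) LZ mul0r.
(* L is nonnegative on this root and, by [root_neg], on its opposite: the point lies on the wall
   just crossed, and its coordinates survive the crossing. *)
have Lneg : L (root x s) = 0.
  apply/eqP; rewrite eq_le hx andbT.
  have [c hc e] := root_neg hs.
  have : 0 <= L (- root x s).
    rewrite e; elim/big_ind: _ => [|u v|i _]; rewrite ?L0 // ?LD ?LZ.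
      exact: addr_ge0.
    exact: mulr_ge0.
  by rewrite -scaleN1r LZ mulN1r oppr_ge0.
have Lsw i : L (root (sw s x) i) = L (root x i).
  by rewrite root_sw -scaleNr LD LZ Lneg mulr0 addr0.
have [|//|i|h1 h2] := IH (sw s x); [lia | by rewrite Lsw |].
split=> [i|T f hf]; first by rewrite -Lsw.
by rewrite -(h2 T f hf) hf // -h1 Lsw.
Qed.

End Tits.

(** * The developing map *)

Section Development.
Variables p q : nat.
Hypotheses (hp : (3 < p)%N) (hq : (3 < q)%N).
Variables (A : nzRingType) (S0 S1 S2 : A).
Hypotheses (S0K : S0 * S0 = 1) (S1K : S1 * S1 = 1) (S2K : S2 * S2 = 1).
Hypothesis S02 : S0 * S2 = S2 * S0.

(* Rotations about a vertex, an edge and a face; kept abstract so that [mulrA]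
   does not look through them. *)
Variables Y Z T T' : A.
Hypotheses (YE : Y = S2 * S1) (ZE : Z = S2 * S0) (TE : T = S0 * S1)
  (T'E : T' = S1 * S0) (S01 : T ^+ p = 1) (S21 : Y ^+ q = 1).

(* From u turn to its child number m / (p - 2), then walk m mod (p - 2) steps
   along the boundary of a face. *)
Fixpoint dev_vertex (v : seq nat) : A :=
  if v is m :: u then
    Y ^+ (1 + (p - 2 %| m)) * Z * T' ^+ (m %% (p - 2)) * Y ^+ (m %/ (p - 2))
    * dev_vertex u
  else 1.

Lemma ZZ : Z * Z = 1.
Proof. by rewrite ZE -{1}S02 mulrA -(mulrA S0) S2K mulr1 S0K. Qed.

Lemma ZY : Z * Y = T.
Proof. by rewrite ZE YE TE -S02 mulrA -(mulrA S0) S2K mulr1. Qed.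

Lemma YT' : Y * T' = Z.
Proof. by rewrite YE T'E ZE mulrA -(mulrA S2) S1K mulr1. Qed.

Lemma YqZ : Y ^+ (q - 1) * Z = T'.
Proof.
rewrite -YT' mulrA -exprSr; have -> : (q - 1).+1 = q by lia.
by rewrite S21 mul1r.
Qed.

Lemma T'X n : (n <= p)%N -> T' ^+ (p - n) = T ^+ n.
Proof.
have TX k : T ^+ k * T' ^+ k = 1.
  elim: k => [|k IH]; first by rewrite mulr1.
  rewrite exprSr exprS mulrA -(mulrA _ T) (_ : T * T' = 1) ?mulr1 //.
  by rewrite TE T'E mulrA -(mulrA S0) S1K mulr1.
move=> h; have : T ^+ (n + (p - n)) * T' ^+ (p - n) = T ^+ n.
  by rewrite exprD -mulrA TX mulr1.
by rewrite subnKC // S01 mul1r.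
Qed.

(** The index of the dart to the right neighbour and the initial turn in [dev_vertex] add up to q -
    1 for both types of vertices, so [YqZ] turns them into one more step T' along the face. *)
Lemma dev_nxt_aux m u : Y * Z * Y ^+ nout p q (m :: u) * dev_vertex (m :: u) =
  Y * Z * T' ^+ (m %% (p - 2)).+1 * Y ^+ (m %/ (p - 2)) * dev_vertex u.
Proof.
rewrite [dev_vertex (_ :: _)]/= !mulrA; congr (_ * _ * _).
rewrite -(mulrA (Y * Z) (Y ^+ _) (Y ^+ _)) -exprD -(mulrA (Y * Z) _ Z).
have -> : (nout p q (m :: u) + (1 + (p - 2 %| m)) = q - 1)%N.
  by rewrite /=; case: ifP => _; lia.
by rewrite YqZ -(mulrA (Y * Z) T') -exprS.
Qed.

(** The right neighbour is the next vertex on top of the same face, or the next child of u, or the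
    first child of the right neighbour of u. The last two cases close a face by T ^+ p = 1; the
    third also uses induction on u, or Y ^+ q = 1 at the root. *)
Lemma dev_nxt v : vaddr p q v -> v <> [::] ->
  dev_vertex (nxt p q v) = Y * Z * Y ^+ nout p q v * dev_vertex v.
Proof.
have ZT n : Z * T ^+ n.+1 = Y * T ^+ n by rewrite exprS mulrA -ZY mulrA ZZ mul1r.
elim: v => // m u IH /andP[hm hu] _; rewrite dev_nxt_aux.
have hmod : (m %% (p - 2) < p - 2)%N by rewrite ltn_mod; lia.
have em := divn_eq m (p - 2).
rewrite [nxt _ _ _]/=; case: ifP => h.
  rewrite [dev_vertex (_ :: _)]/=; congr (_ * _).
  case: (ltnP (m %% (p - 2)).+1 (p - 2)) => hj.
    have e : m.+1 = (m %/ (p - 2) * (p - 2) + (m %% (p - 2)).+1)%N by lia.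
    have -> : (m.+1 %% (p - 2) = (m %% (p - 2)).+1)%N.
      by rewrite e modnMDl modn_small.
    have -> : (m.+1 %/ (p - 2) = m %/ (p - 2))%N.
      by rewrite {1}e divnMDl; [rewrite (divn_small hj) addn0 | lia].
    rewrite /dvdn; have -> : (m.+1 %% (p - 2) == 0)%N = false.
      by rewrite e modnMDl modn_small.
    by rewrite addn0 expr1.
  have e : (m.+1 = (m %/ (p - 2)).+1 * (p - 2))%N by rewrite mulSn; lia.
  have -> : (m.+1 %% (p - 2) = 0)%N by rewrite e modnMl.
  have -> : (m.+1 %/ (p - 2) = (m %/ (p - 2)).+1)%N by rewrite e mulnK //; lia.
  rewrite e dvdn_mull // mulr1.
  have -> : ((m %% (p - 2)).+1 = p - 2)%N by lia.
  rewrite T'X; last lia.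
  rewrite -(mulrA Y Z) ZT expr1 -ZY (exprS _ (_ %/ _)) !mulrA.
  by rewrite expr2.
have {h}hm' : m.+1 = nsucc p q u by move: h hm; case: ltngtP.
rewrite [dev_vertex (_ :: _)]/= mod0n div0n dvdn0 !mulr1 expr2.
case: u IH hu hm hm' => [|m' u] IH hu hm hm'.
  have e : m = ((q - 1) * (p - 2) + (p - 3))%N by move: hm'; rewrite /=; nia.
  have -> : (m %/ (p - 2) = q - 1)%N.
    by rewrite e divnMDl; [rewrite divn_small ?addn0 //; lia | lia].
  have -> : ((m %% (p - 2)).+1 = p - 2)%N by rewrite e modnMDl modn_small; lia.
  rewrite T'X; last lia.
  rewrite -(mulrA Y Z) ZT expr1 -ZY /= !mulr1 !mulrA.
  rewrite -(mulrA _ Y (Y ^+ _)) -exprS (_ : (q - 1).+1 = q); last lia.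
  by rewrite S21 mulr1.
have e := nsucc_pred hp hq (v := m' :: u); rewrite -hm' /= in e.
have {}e : m = ((nout p q (m' :: u)).-1 * (p - 2) + (p - 4))%N by rewrite mulnC; exact: e.
have -> : (m %/ (p - 2) = (nout p q (m' :: u)).-1)%N.
  by rewrite e divnMDl; [rewrite divn_small ?addn0 //; lia | lia].
have -> : ((m %% (p - 2)).+1 = p - 3)%N by rewrite e modnMDl modn_small; lia.
rewrite T'X; last lia.
rewrite IH // -(mulrA Y Z (T ^+ _)) ZT expr2 -ZY !mulrA.
rewrite -(mulrA _ Y (Y ^+ _)) -exprS prednK //.
exact: (nout_gt0 hp hq).
Qed.

Definition dev_dart (d : seq nat * nat) : A := Y ^+ d.2 * dev_vertex d.1.

(** For a dart to a child this is the definition of [dev_vertex], for the right neighbour it is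
    [dev_nxt]; the parent and the left neighbour follow because Z is an involution. *)
Lemma dev_opp d : vdart p q d -> dev_dart (opp_dart p q d) = Z * dev_dart d.
Proof.
have out v k : (k < nout p q v)%N ->
    dev_dart ((p - 2) * k :: v, q - 2)%N = Z * dev_dart (v, k).
  move=> hk; rewrite /dev_dart /= dvdn_mulr // mulKn ?modnMr; last lia.
  rewrite mulr1 !mulrA -!exprSr (_ : (q - 2).+2 = q); last lia.
  by rewrite S21 mul1r.
have nx v : vaddr p q v -> v <> [::] ->
    dev_dart (nxt p q v, q - 1)%N = Z * dev_dart (v, nout p q v).
  move=> hv v0; rewrite /dev_dart /= dev_nxt // !mulrA -exprSr.
  rewrite (_ : (q - 1).+1 = q); last lia.
  by rewrite S21 mul1r.
have swap x y : y = Z * x -> x = Z * y by move=> ->; rewrite mulrA ZZ mul1r.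
case: d => v k hd; case/andP: (hd) => hv hk.
case: (opp_dartP hp hq hd) => [h|kq v0 h|kr v0 h|m u ev kq hm hu].
- exact: out.
- apply: swap; have := nx (prv p q v); rewrite prvK // kq; apply.
    exact: vaddr_prv.
  by move=> e; apply: v0; move: (size_prv p q v); rewrite e; case: (v).
- by rewrite kr; apply: nx.
- apply: swap; rewrite kq ev -(out _ _ (div_nout hp hq hu)).
  by rewrite mulnC divnK.
Qed.

Definition dev (x : flag p q) : A :=
  (if (val x).2 then 1 else S2) * dev_dart (val x).1.

Definition gen (i : 'I_3) : A := match val i with 0%N => S0 | 1%N => S1 | _ => S2 end.

Lemma dev_fsw i x : dev (fsw hp hq i x) = gen i * dev x.
Proof.
case: (flagP x) => v [k [b [hv [hk ->]]]].
have hd : vdart p q (v, k) by apply/andP.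
rewrite /gen /fsw; case: (val i) => [|[|n]].
- rewrite /dev -[val _]/(opp_dart p q (v, k), ~~ b) dev_opp // ZE.
  case: b; rewrite /= !mulrA ?mul1r ?mulr1 ?S2K ?mul1r //.
  by rewrite -S02.
- rewrite /dev /=; case: b => /=; rewrite /dev_dart /=.
    rewrite mul1r /dsucc; case: ifP => h; first by rewrite exprS YE !mulrA S2K mul1r.
    have -> : S1 * (Y ^+ k * dev_vertex v) = S2 * Y ^+ k.+1 * dev_vertex v.
      by rewrite exprS YE !mulrA S2K mul1r.
    have -> : k.+1 = q by lia.
    by rewrite S21 mulr1 expr0 mul1r.
  have e n : S1 * (S2 * Y ^+ n.+1) = Y ^+ n.
    by rewrite exprS {1}YE !mulrA -(mulrA S1 S2 S2) S2K mulr1 S1K mul1r.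
  case: k hk hd => [|k] hk hd /=; last by rewrite !mul1r !mulrA -(mulrA S1) e.
  rewrite mul1r expr0 mul1r -(e q.-1) prednK ?(leq_trans _ hq) // S21 mulr1.
  by rewrite mulrA.
- by rewrite /dev /=; case: b => /=; rewrite ?mul1r // !mulrA S2K mul1r.
Qed.

End Development.

(** * Lorentz geometry of the base cell *)

Lemma ord3P (P : 'I_3 -> Prop) : P 0 -> P 1 -> P ord_max -> forall i, P i.
Proof.
move=> h0 h1 h2 [[|[|[|//]]] hi].
- by rewrite (_ : Ordinal hi = 0) //; apply: val_inj.
- by rewrite (_ : Ordinal hi = 1) //; apply: val_inj.
- by rewrite (_ : Ordinal hi = ord_max) //; apply: val_inj.
Qed.

Lemma sum_ord3 (V : nmodType) (f : 'I_3 -> V) :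
  \sum_(i < 3) f i = f 0 + f 1 + f ord_max.
Proof.
rewrite !big_ord_recl big_ord0 addr0 addrA.
by congr (_ + _ + _); congr f; apply: val_inj.
Qed.

Lemma row3P (R : realType) (x y : 'rV[R]_3) :
  x 0 0 = y 0 0 -> x 0 1 = y 0 1 -> x 0 ord_max = y 0 ord_max -> x = y.
Proof. by move=> h0 h1 h2; apply/rowP; apply: ord3P. Qed.

Section Lorentz.
Variable R : realType.
Implicit Types x y z e : 'rV[R]_3.

Lemma lorentzC x y : lorentz x y = lorentz y x.
Proof. by rewrite /lorentz; ring. Qed.

Lemma lorentzDl x y z : lorentz (x + y) z = lorentz x z + lorentz y z.
Proof. by rewrite /lorentz !mxE; ring. Qed.

Lemma lorentzZl a x z : lorentz (a *: x) z = a * lorentz x z.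
Proof. by rewrite /lorentz !mxE; ring. Qed.

Lemma lorentzDr x y z : lorentz z (x + y) = lorentz z x + lorentz z y.
Proof. by rewrite /lorentz !mxE; ring. Qed.

Lemma lorentzZr a x z : lorentz z (a *: x) = a * lorentz z x.
Proof. by rewrite /lorentz !mxE; ring. Qed.

Lemma lorentz0l x : lorentz 0 x = 0.
Proof. by rewrite /lorentz !mxE; ring. Qed.

Lemma lorentz_suml (I : Type) (r : seq I) (P : pred I) (f : I -> 'rV[R]_3) z :
  lorentz (\sum_(i <- r | P i) f i) z = \sum_(i <- r | P i) lorentz (f i) z.
Proof. by elim/big_rec2: _ => [|i a b _ <-]; rewrite ?lorentz0l ?lorentzDl. Qed.

Lemma lorentz_mull (a : 'rV[R]_3) (N : 'M[R]_3) z :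
  lorentz (a *m N) z = \sum_i a 0 i * lorentz (row i N) z.
Proof.
rewrite mulmx_sum_row lorentz_suml; apply: eq_bigr => i _.
by rewrite lorentzZl.
Qed.

Definition refl e z : 'rV[R]_3 := z - (2 * lorentz z e) *: e.

Lemma reflE e z : refl e z = z + (- 2 * lorentz z e) *: e.
Proof. by rewrite /refl mulNr scaleNr. Qed.

Lemma lorentz_refl e x y : lorentz e e = 1 ->
  lorentz (refl e x) (refl e y) = lorentz x y.
Proof.
move=> e1; rewrite !reflE lorentzDl !lorentzDr !lorentzZl !lorentzZr e1.
rewrite (lorentzC e y); move: (lorentz x e) (lorentz y e) (lorentz x y) => a b c.
by ring.
Qed.

(* Both sheets are preserved because the form of a point and its mirror image
   is at most -1. *)
Lemma hyperbolic_refl e x : lorentz e e = 1 ->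
  hyperbolic_plane x -> hyperbolic_plane (refl e x).
Proof.
move=> e1 [h1 h2]; have h3 := lorentz_refl x x e1.
split; first by rewrite h3.
set y := refl e x; rewrite h1 -/y in h3.
have h4 : lorentz x y = -1 - 2 * lorentz x e ^+ 2.
  by rewrite /y reflE lorentzDr h1 lorentzZr; ring.
have sq := sqr_ge0 (lorentz x e).
rewrite /lorentz in h1 h3 h4.
move: (lorentz x e ^+ 2) h4 sq => s h4 sq.
move: (x 0 0) (x 0 1) (x 0 ord_max) (y 0 0) (y 0 1) (y 0 ord_max) h1 h2 h3 h4.
move=> a b c a' b' c' h1 h2 h3 h4.
rewrite ltNge; apply/negP => hc'.
have CS : (a * a' + b * b') ^+ 2 <= (c * c') ^+ 2 - 1.
  have : (a * a' + b * b') ^+ 2 <= (a * a + b * b) * (a' * a' + b' * b').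
    by have := sqr_ge0 (a * b' - b * a'); nra.
  have -> : a * a + b * b = c * c - 1 by lra.
  have -> : a' * a' + b' * b' = c' * c' - 1 by lra.
  have : 1 <= c * c by have := sqr_ge0 a; have := sqr_ge0 b; lra.
  have : 1 <= c' * c' by have := sqr_ge0 a'; have := sqr_ge0 b'; lra.
  by nra.
have hY : c * c' <= 0 by rewrite pmulr_rle0.
move: (c * c') (a * a' + b * b') hY h4 CS => Y X hY h4 CS.
by nra.
Qed.

End Lorentz.

(** * Frames with a prescribed Gram matrix *)

Section Frames.
Variables (R : realType) (K : 'I_3 -> 'I_3 -> R).
Hypotheses (K1 : forall i, K i i = 1) (K_sym : forall i j, K i j = K j i).

(** Acts on a frame from the left, hence in the coordinates of that frame: one matrix describes the
    reflection in wall i of every chamber. *)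
Definition simple_refl (i : 'I_3) : 'M[R]_3 :=
  \matrix_(j, l) ((j == l)%:R - 2 * K j i * (i == l)%:R).

Local Notation S := simple_refl.

Lemma row_simple_refl i j (N : 'M[R]_3) :
  row j (S i *m N) = row j N - (2 * K j i) *: row i N.
Proof.
apply/rowP => l; rewrite !mxE.
under eq_bigr => k _ do rewrite !mxE mulrBl.
rewrite big_split /= sumrN (bigD1 j) //= eqxx mul1r big1; last first.
  by move=> k /negPf; rewrite eq_sym => ->; rewrite mul0r.
rewrite (bigD1 i) //= eqxx mulr1 big1 ?addr0 // => k /negPf.
by rewrite eq_sym => ->; rewrite mulr0 mul0r.
Qed.

Lemma simple_reflK i : S i *m S i = 1%:M.
Proof.
apply/row_matrixP => j; rewrite -[X in _ *m X]mulmx1 !row_simple_refl K1.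
set v := row i _; have -> : v - (2 * 1) *: v = - v.
  by rewrite mulr1 scaler_nat mulr2n opprD addrA subrr sub0r.
by rewrite scalerN opprK subrK.
Qed.

Lemma simple_reflC i j : K i j = 0 -> S i *m S j = S j *m S i.
Proof.
move=> ij; have ji : K j i = 0 by rewrite K_sym.
apply/row_matrixP => l.
rewrite -(mulmx1 (S i *m S j)) -(mulmx1 (S j *m S i)) -!mulmxA.
by rewrite !row_simple_refl ij ji !mulr0 !scale0r !subr0 addrAC.
Qed.

Definition gram (N : 'M[R]_3) : Prop :=
  forall i j, lorentz (row i N) (row j N) = K i j.

Lemma lorentz_gram (N : 'M[R]_3) (a : 'rV[R]_3) j : gram N ->
  lorentz (a *m N) (row j N) = \sum_i a 0 i * K i j.
Proof. by move=> h; rewrite lorentz_mull; apply: eq_bigr => i _; rewrite h. Qed.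

Lemma lorentz_gram2 (N N' : 'M[R]_3) (a b : 'rV[R]_3) : gram N -> gram N' ->
  lorentz (a *m N) (b *m N) = lorentz (a *m N') (b *m N').
Proof.
move=> h h'; rewrite !lorentz_mull; apply: eq_bigr => i _; congr (_ * _).
by rewrite lorentzC (lorentzC _ (b *m N')) !lorentz_gram.
Qed.

(** Keeping the coordinates of a point while changing the frame by [S i] mirrors the point in wall
    i; every attached point moves by this rule. *)
Lemma mulmx_simple_refl (N : 'M[R]_3) (a : 'rV[R]_3) i : gram N ->
  a *m (S i *m N) = refl (row i N) (a *m N).
Proof.
move=> h; rewrite /refl lorentz_gram // mulmx_sum_row.
under eq_bigr => j _ do rewrite row_simple_refl scalerBr.
rewrite big_split /= -mulmx_sum_row sumrN; congr (_ - _).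
rewrite mulr_sumr scaler_suml; apply: eq_bigr => j _.
by rewrite scalerA mulrCA.
Qed.

Lemma row_refl (N : 'M[R]_3) i j : gram N ->
  row j (S i *m N) = refl (row i N) (row j N).
Proof. by move=> h; rewrite row_simple_refl /refl h. Qed.

Lemma gram_simple_refl (N : 'M[R]_3) i : gram N -> gram (S i *m N).
Proof. by move=> h j l; rewrite !row_refl // lorentz_refl h. Qed.

End Frames.

(** * Rotations about the axis of the base cell *)

Section Rotations.
Variable R : realType.

Definition rotz (t : R) : 'M[R]_3 :=
  \matrix_(i, j) (match val i with
    | 0%N => row3 (cos t) (sin t) 0
    | 1%N => row3 (- sin t) (cos t) 0
    | _ => row3 0 0 1 end) 0 j.

Lemma mulmx_rotz (z : 'rV[R]_3) t : z *m rotz t =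
  row3 (z 0 0 * cos t - z 0 1 * sin t) (z 0 0 * sin t + z 0 1 * cos t) (z 0 ord_max).
Proof. by apply: row3P; rewrite !mxE sum_ord3 !mxE /=; ring. Qed.

Lemma rotzD s t : rotz s *m rotz t = rotz (s + t).
Proof.
apply/row_matrixP => i; rewrite row_mul mulmx_rotz.
by move: i; apply: ord3P; apply: row3P; rewrite !mxE /= ?cosD ?sinD; ring.
Qed.

Lemma rotz0 : rotz 0 = 1%:M.
Proof.
apply/matrixP => i j; move: i j.
by apply: ord3P; apply: ord3P; rewrite !mxE /= ?cos0 ?sin0 ?oppr0.
Qed.

Lemma rotz_exp t n : rotz t ^+ n = rotz (n%:R * t).
Proof.
elim: n => [|n IH]; first by rewrite expr0 mul0r rotz0.
rewrite exprS IH -[_ * _]/(_ *m _) rotzD; congr rotz.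
by rewrite -[n.+1]addn1 natrD; ring.
Qed.

Lemma refl_refl (e x z : 'rV[R]_3) : lorentz e e = 1 ->
  refl (refl e x) (refl e z) = refl e (refl x z).
Proof.
move=> e1; rewrite {1}/refl lorentz_refl // !reflE.
have L : lorentz (z + (-2 * lorentz z x) *: x) e =
   lorentz z e - 2 * lorentz z x * lorentz x e.
  by rewrite lorentzDl lorentzZl mulNr mulNr.
rewrite L; apply/rowP => j; rewrite !mxE; ring.
Qed.

End Rotations.

(** * Trigonometry of the angles pi / n *)

Section Trigonometry.
Variables (R : realType).

Lemma pi_n_itv n : (1 < n)%N -> 0 < pi / n%:R :> R /\ pi / n%:R < pi :> R.
Proof.
move=> hn; have n0 : 0 < n%:R :> R by rewrite ltr0n; lia.
split; first by rewrite divr_gt0 ?pi_gt0.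
by rewrite ltr_pdivrMr // ltr_pMr ?pi_gt0 // ltr1n.
Qed.

Lemma sin_pi_n_gt0 n : (1 < n)%N -> 0 < sin (pi / n%:R) :> R.
Proof. by move=> /pi_n_itv[h1 h2]; apply: sin_gt0_pi; rewrite h1. Qed.

Lemma cos_pi_n_gt0 n : (3 < n)%N -> 0 < cos (pi / n%:R) :> R.
Proof.
move=> hn; have [|h1 _] := @pi_n_itv n; first lia.
apply: cos_gt0_pihalf; apply/andP; split.
  by apply: lt_trans h1; rewrite oppr_lt0 divr_gt0 ?pi_gt0.
rewrite ltr_pM2l ?pi_gt0 // ltf_pV2 ?posrE ?ltr0n ?ltr_nat //; lia.
Qed.

Lemma cos_pi4 : cos (pi / 4) ^+ 2 = 1 / 2 :> R.
Proof.
have := cos_mulr2n (pi / 4 : R).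
have -> : pi / 4 *+ 2 = pi / 2 :> R by rewrite -mulr_natr; field.
by rewrite cos_pihalf -mulr_natr => e; lra.
Qed.

(** Strict above 4: with the weak bound at 4 this makes the squared cosines of pi / p and pi / q add
    up to more than 1 in the hyperbolic case. *)
Lemma cos_pi_n_gt n : (4 < n)%N -> 1 / 2 < cos (pi / n%:R) ^+ 2 :> R.
Proof.
move=> hn; have [|h1 h1'] := @pi_n_itv n; first lia.
have [//|h2 h2'] := @pi_n_itv 4.
rewrite -cos_pi4 ltr_pXn2r ?nnegrE ?ltW ?cos_pi_n_gt0 //; last lia.
rewrite ltr_cos ?in_itv /= ?ltW //.
by rewrite ltr_pM2l ?pi_gt0 // ltf_pV2 ?posrE ?ltr0n ?ltr_nat //; lia.
Qed.

Lemma cos_pi_n_ge n : (3 < n)%N -> 1 / 2 <= cos (pi / n%:R) ^+ 2 :> R.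
Proof.
rewrite leq_eqVlt => /predU1P[<-|/cos_pi_n_gt/ltW//].
by rewrite cos_pi4.
Qed.

Lemma chebyshev_sin n (k : R) : (1 < n)%N -> k = - cos (pi / n%:R) ->
  exists u : nat -> R,
  [/\ u 0%N = 0, u 1%N = 1, forall i, u i.+2 = - (2 * k) * u i.+1 - u i
    & forall i, (i <= n)%N -> 0 <= u i].
Proof.
move=> hn ->; have s0 := sin_pi_n_gt0 hn; set t := pi / n%:R.
exists (fun i => sin (i%:R * t) / sin t); split.
- by rewrite mul0r sin0 mul0r.
- by rewrite mul1r divff ?gt_eqF.
- move=> i; have -> : sin (i.+2%:R * t) =
      2 * cos t * sin (i.+1%:R * t) - sin (i%:R * t).
    have -> : i.+2%:R * t = i.+1%:R * t + t by rewrite -[i.+2]addn1 natrD; ring.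
    have -> : i%:R * t = i.+1%:R * t - t by rewrite -[i.+1]addn1 natrD; ring.
    by rewrite sinD sinB; ring.
  by rewrite -/t; ring.
- move=> i hi; rewrite divr_ge0 ?(ltW s0) // sin_ge0_pi //.
  have n0 : 0 < n%:R :> R by rewrite ltr0n; lia.
  apply/andP; split; first by rewrite mulr_ge0 ?divr_ge0 ?pi_ge0 ?ler0n.
  rewrite /t mulrCA ger_pMr ?pi_gt0 // ler_pdivrMr // mul1r ler_nat //.
Qed.

End Trigonometry.

(** * Gram matrix and orders of the generators *)

Section Coxeter.
Variables (R : realType) (p q : nat).

(* [i + j] tells the three pairs of distinct generators apart. *)
Definition cox_gram (i j : 'I_3) : R :=
  if i == j then 1 else
  match (i + j)%N with
  | 1%N => - cos (pi / p%:R) | 3%N => - cos (pi / q%:R) | _ => 0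
  end.

Definition cox_order (i j : 'I_3) : nat :=
  match (i + j)%N with 1%N => p | 3%N => q | _ => 2%N end.

Lemma cox_gram1 i : cox_gram i i = 1.
Proof. by rewrite /cox_gram eqxx. Qed.

Lemma cox_gramC i j : cox_gram i j = cox_gram j i.
Proof. by rewrite /cox_gram eq_sym addnC. Qed.

Lemma cox_gramE :
  [/\ cox_gram 0 1 = - cos (pi / p%:R), cox_gram 1 ord_max = - cos (pi / q%:R)
    & cox_gram 0 ord_max = 0].
Proof. by split. Qed.

Hypotheses (hp : (3 < p)%N) (hq : (3 < q)%N).

Lemma cox_cheb i j : i != j -> exists u : nat -> R,
  [/\ u 0%N = 0, u 1%N = 1,
    forall n, u n.+2 = - (2 * cox_gram i j) * u n.+1 - u n
    & forall n, (n <= cox_order i j)%N -> 0 <= u n].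
Proof.
have h0 : 0 = - cos (pi / 2%:R) :> R by rewrite cos_pihalf oppr0.
move: i j; apply: ord3P; apply: ord3P => // _; rewrite /cox_gram /cox_order /=;
  by apply: chebyshev_sin => //; lia.
Qed.

End Coxeter.

(** * The base chamber *)

Section BaseFrame.
Variables (R : realType) (p q : nat).
Hypotheses (hp : (3 < p)%N) (hq : (3 < q)%N) (hpq : (4 < (p - 2) * (q - 2))%N).

Let sp : R := sin (pi / p%:R).
Let cp : R := cos (pi / p%:R).
Let sq : R := sin (pi / q%:R).
Let cq : R := cos (pi / q%:R).
(** The square is minus the determinant of [cox_gram], so its positivity is the hyperbolicity of
    {p,q}. *)
Let D : R := Num.sqrt (cp ^+ 2 + cq ^+ 2 - 1).

Let sp0 : 0 < sp. Proof. by apply: sin_pi_n_gt0; lia. Qed.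
Let sq0 : 0 < sq. Proof. by apply: sin_pi_n_gt0; lia. Qed.
Let cp0 : 0 < cp. Proof. exact: cos_pi_n_gt0. Qed.
Let cq0 : 0 < cq. Proof. exact: cos_pi_n_gt0. Qed.
Let csp : cp ^+ 2 + sp ^+ 2 = 1. Proof. exact: cos2Dsin2. Qed.
Let csq : cq ^+ 2 + sq ^+ 2 = 1. Proof. exact: cos2Dsin2. Qed.

Let D2 : D ^+ 2 = cp ^+ 2 + cq ^+ 2 - 1 /\ 0 < D.
Proof.
have h : 0 < cp ^+ 2 + cq ^+ 2 - 1.
  have h1 := @cos_pi_n_ge R p hp; have h2 := @cos_pi_n_ge R q hq.
  have [h|h] : (4 < p)%N \/ (4 < q)%N by nia.
    by have := @cos_pi_n_gt R p h; rewrite -/cp -/cq in h1 h2 *; lra.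
  by have := @cos_pi_n_gt R q h; rewrite -/cp -/cq in h1 h2 *; lra.
by rewrite sqr_sqrtr ?ltW // sqrtr_gt0.
Qed.

Let e0 : 'rV[R]_3 := row3 sp cp 0.
Let e1 : 'rV[R]_3 := row3 0 (- 1) 0.
Let e2 : 'rV[R]_3 := row3 (- (cq * cp / sp)) cq (- (D / sp)).

(* The rows are unit normals to the walls of the triangle formed by the centre
   of the base cell, its vertex 0 and the midpoint of a side at this vertex. *)
Definition base_frame : 'M[R]_3 :=
  \matrix_(i, j) (match val i with 0%N => e0 | 1%N => e1 | _ => e2 end) 0 j.

Lemma row_base_frame :
  [/\ row 0 base_frame = e0, row 1 base_frame = e1 & row ord_max base_frame = e2].
Proof. by split; apply/rowP => j; rewrite !mxE. Qed.

Local Notation K := (cox_gram R p q).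
Local Notation S := (simple_refl K).

Lemma gram_base_frame : gram K base_frame.
Proof.
have [r0 r1 r2] := row_base_frame; have [k01 k12 k02] := cox_gramE R p q.
have [d2 d0] := D2.
have l00 : lorentz e0 e0 = 1 by rewrite /lorentz !mxE -csp /=; ring.
have l11 : lorentz e1 e1 = 1 by rewrite /lorentz !mxE /=; ring.
have l22 : lorentz e2 e2 = 1.
  rewrite /lorentz !mxE /=.
  have -> : - (cq * cp / sp) * - (cq * cp / sp) + cq * cq -
     - (D / sp) * - (D / sp) = (cq ^+ 2 * cp ^+ 2 + cq ^+ 2 * sp ^+ 2 - D ^+ 2) / sp ^+ 2.
    by field; rewrite gt_eqF.
  rewrite d2 -mulrDr csp mulr1.
  have -> : cq ^+ 2 - (cp ^+ 2 + cq ^+ 2 - 1) = sp ^+ 2 by rewrite -csp; ring.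
  by rewrite divff // expf_neq0 // gt_eqF.
have l01 : lorentz e0 e1 = - cp by rewrite /lorentz !mxE /=; ring.
have l12 : lorentz e1 e2 = - cq by rewrite /lorentz !mxE /=; ring.
have l02 : lorentz e0 e2 = 0.
  by rewrite /lorentz !mxE /=; field; rewrite gt_eqF.
apply: ord3P; apply: ord3P; rewrite ?r0 ?r1 ?r2 ?cox_gram1 //.
all: by rewrite lorentzC cox_gramC ?k01 ?k12 ?k02.
Qed.

Lemma base_frame_unit : base_frame \in unitmx.
Proof.
rewrite -row_free_unit -kermx_eq0; apply/eqP/row_matrixP => i; rewrite row0.
have : row i (kermx base_frame) *m base_frame = 0 by rewrite -row_mul mulmx_ker row0.
move: (row i _) => x; have [d2 d0] := D2.
move/rowP => h; have := h 0; have := h 1; have := h ord_max.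
rewrite !mxE !sum_ord3 !mxE /= => h2 h1 h0.
have x2 : x 0 ord_max = 0.
  have : x 0 ord_max * (D / sp) = 0 by lra.
  by move/eqP; rewrite mulf_eq0 (gt_eqF (divr_gt0 d0 sp0)) orbF => /eqP.
rewrite x2 in h0 h1.
have x0 : x 0 0 = 0.
  have : x 0 0 * sp = 0 by lra.
  by move/eqP; rewrite mulf_eq0 (gt_eqF sp0) orbF => /eqP.
rewrite x0 in h1.
by apply: row3P; rewrite mxE //; lra.
Qed.

(** Vertex 0 of [base_cell], with sinh r in closed form. *)
Definition base_vertex : 'rV[R]_3 := row3 (D / (sp * sq)) 0 (cp / sp * (cq / sq)).

Let T : 'M[R]_3 := S 0 *m S 1.
Let theta : R := 2 * pi / p%:R.

Lemma base_cellE (k : 'I_p) :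
  @base_cell R p q k = base_vertex *m rotz (k%:R * theta).
Proof.
rewrite mulmx_rotz !mxE /= /base_cell /base_vertex.
have tanV n : (tan (pi / n%:R))^-1 = cos (pi / n%:R) / sin (pi / n%:R) :> R.
  by rewrite /tan invf_div.
rewrite !tanV -/cp -/sp -/cq -/sq.
have -> : Num.sqrt ((cp / sp * (cq / sq)) ^+ 2 - 1) = D / (sp * sq).
  have [d2 d0] := D2.
  have -> : (cp / sp * (cq / sq)) ^+ 2 - 1 = (D / (sp * sq)) ^+ 2.
    have es : (sp * sq) ^+ 2 = 1 - cp ^+ 2 - cq ^+ 2 + cp ^+ 2 * cq ^+ 2.
      have -> : (sp * sq) ^+ 2 = (1 - cp ^+ 2) * (1 - cq ^+ 2).
        by rewrite exprMn -{1}csp -csq; ring.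
      by ring.
    have nz : (sp * sq) ^+ 2 != 0 by rewrite expf_neq0 // mulf_neq0 // gt_eqF.
    have -> : (cp / sp * (cq / sq)) ^+ 2 = (cp ^+ 2 * cq ^+ 2) / (sp * sq) ^+ 2.
      by field; rewrite !gt_eqF.
    apply: (mulIf nz); rewrite mulrBl expr_div_n d2 !divfK // mul1r es; ring.
  by rewrite sqrtr_sqr ger0_norm // divr_ge0 ?mulr_ge0 ?ltW.
have -> : 2 * pi * k%:R / p%:R = k%:R * theta by rewrite /theta; ring.
by rewrite !mul0r subr0 addr0.
Qed.

Lemma base_vertex_hyp : hyperbolic_plane base_vertex.
Proof.
have [d2 d0] := D2; split; last by rewrite !mxE /= mulr_gt0 ?divr_gt0.
rewrite /lorentz !mxE /=.
have -> : D / (sp * sq) * (D / (sp * sq)) + 0 * 0 -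
    cp / sp * (cq / sq) * (cp / sp * (cq / sq)) =
    (D ^+ 2 - cp ^+ 2 * cq ^+ 2) / (sp ^+ 2 * sq ^+ 2).
  by field; rewrite !gt_eqF.
have es : sp ^+ 2 * sq ^+ 2 = 1 - cp ^+ 2 - cq ^+ 2 + cp ^+ 2 * cq ^+ 2.
  have -> : sp ^+ 2 = 1 - cp ^+ 2 by rewrite -csp; ring.
  have -> : sq ^+ 2 = 1 - cq ^+ 2 by rewrite -csq; ring.
  by ring.
have -> : D ^+ 2 - cp ^+ 2 * cq ^+ 2 = - (sp ^+ 2 * sq ^+ 2) by rewrite es d2; ring.
by rewrite mulNr divff // mulf_neq0 // expf_neq0 // gt_eqF.
Qed.

Lemma lorentz_base_vertex : exists2 l, 0 < l &
  forall j, lorentz base_vertex (row j base_frame) = l * (j == 0)%:R.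
Proof.
have [d2 d0] := D2; have [r0 r1 r2] := row_base_frame.
exists (D / sq); first exact: divr_gt0.
apply: ord3P; rewrite ?r0 ?r1 ?r2 /lorentz !mxE /=; field; rewrite !gt_eqF //.
Qed.

Lemma lorentz_base_centre : exists2 l, 0 < l &
  forall j, lorentz (row3 0 0 1) (row j base_frame) = l * (j == ord_max)%:R.
Proof.
have [d2 d0] := D2; have [r0 r1 r2] := row_base_frame.
exists (D / sp); first exact: divr_gt0.
apply: ord3P; rewrite ?r0 ?r1 ?r2 /lorentz !mxE /=; field; rewrite !gt_eqF //.
Qed.

(** Walls 0 and 1 pass through the centre at angle pi / p, so the product of their reflections is
    the rotation by 2 pi / p. *)
Lemma walk_base_frame : T *m base_frame = base_frame *m rotz theta.
Proof.
have [r0 r1 r2] := row_base_frame; have g := gram_base_frame.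
have g1 := gram_simple_refl (cox_gram1 R p q) 1 g.
apply/row_matrixP => j; rewrite /T -mulmxA [RHS]row_mul (row_refl _ _ g1) !(row_refl _ _ g).
rewrite refl_refl ?g ?cox_gram1 // r0 r1 mulmx_rotz.
have -> : theta = (pi / p%:R) *+ 2 by rewrite /theta -mulr_natr; ring.
rewrite cos_mulr2n sin_mulr2n -/sp -/cp.
have -> : cp ^+ 2 *+ 2 - 1 = cp ^+ 2 - sp ^+ 2 by rewrite -csp mulr2n; ring.
rewrite (mulr2n (cp * sp)).
move: (row j base_frame) => z.
have c1 a : a * (cp ^+ 2 + sp ^+ 2) = a by rewrite csp mulr1.
have h0 := c1 (z 0 0); have h1 := c1 (z 0 1).
apply: row3P; rewrite !mxE /lorentz !mxE /lorentz !mxE /=.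
- by lra.
- by lra.
- by ring.
Qed.

Lemma walk_exp_base_frame n :
  T ^+ n *m base_frame = base_frame *m rotz (n%:R * theta).
Proof.
rewrite -rotz_exp; elim: n => [|n IH]; first by rewrite !expr0 mul1mx mulmx1.
rewrite exprS -[_ * _]/(_ *m _) -mulmxA IH mulmxA walk_base_frame -mulmxA.
by rewrite exprS.
Qed.

Lemma walk_order : T ^+ p = 1.
Proof.
have := walk_exp_base_frame p; have -> : p%:R * theta = pi *+ 2.
  by rewrite /theta -mulr_natr; field; rewrite pnatr_eq0; lia.
have s2 : sin (pi *+ 2) = 0 :> R by rewrite sin_mulr2n sinpi mulr0 mul0rn.
have -> : rotz (pi *+ 2) = 1%:M :> 'M[R]_3.
  apply/matrixP => i j; move: i j.
  by apply: ord3P; apply: ord3P; rewrite !mxE /= ?cos2pi ?s2 ?oppr0.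
rewrite mulmx1 => /(congr1 (fun A => A *m invmx base_frame)).
by rewrite mulmxK ?base_frame_unit // mulmxV ?base_frame_unit.
Qed.

(** The sum is fixed by a rotation by an angle strictly between 0 and pi, hence lies on its axis. *)
Lemma sum_walk : \sum_(k < p) (base_vertex *m rotz (k%:R * theta)) =
  row3 0 0 (p%:R * base_vertex 0 ord_max).
Proof.
set s := \sum_(k < p) _.
have es : s *m rotz theta = s.
  have e n : base_vertex *m rotz (n%:R * theta) *m rotz theta =
      base_vertex *m rotz (n.+1%:R * theta).
    by rewrite -mulmxA rotzD -[n.+1]addn1 natrD; congr (_ *m rotz _); ring.
  rewrite /s mulmx_suml; under eq_bigr => k _ do rewrite e.
  have [p' ep] : exists p', p = p'.+1 by case: (p) hp => // p' _; exists p'.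
  have ew : rotz (p%:R * theta) = rotz (0%:R * theta).
    have := walk_exp_base_frame p; rewrite walk_order mul1mx mul0r rotz0.
    move/(congr1 (mulmx (invmx base_frame))).
    by rewrite mulKmx ?base_frame_unit // mulVmx ?base_frame_unit.
  move: ew; rewrite ep => ew.
  by rewrite big_ord_recr [RHS]big_ord_recl /= ew addrC.
have [t0 t1] : 0 < theta /\ theta < pi.
  have p0 : 0 < p%:R :> R by rewrite ltr0n; lia.
  split; first by rewrite divr_gt0 // mulr_gt0 ?pi_gt0.
  rewrite ltr_pdivrMr // mulrC ltr_pM2l ?pi_gt0 //.
  by rewrite ltr_nat; lia.
have st : 0 < sin theta by apply: sin_gt0_pi; rewrite t0.
rewrite mulmx_rotz in es.
have s2 : s 0 ord_max = p%:R * base_vertex 0 ord_max.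
  rewrite /s summxE (eq_bigr (fun=> base_vertex 0 ord_max)).
    by rewrite sumr_const card_ord mulr_natl.
  by move=> k _; rewrite mulmx_rotz mxE.
have E0 : s 0 0 * cos theta - s 0 1 * sin theta = s 0 0.
  by rewrite -[in RHS]es mxE.
have E1 : s 0 0 * sin theta + s 0 1 * cos theta = s 0 1.
  by rewrite -[in RHS]es mxE.
have sp2 : 0 < sin theta ^+ 2 + (cos theta - 1) ^+ 2.
  by rewrite ltr_wpDr ?sqr_ge0 ?exprn_gt0.
have z0 a b : a * (cos theta - 1) = b * sin theta ->
    a * sin theta = b * (1 - cos theta) -> a = 0.
  move=> h1 h2; apply/eqP; have /eqP : a * (sin theta ^+ 2 + (cos theta - 1) ^+ 2) = 0.
    rewrite mulrDr !expr2 !mulrA h1 h2; ring.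
  by rewrite mulf_eq0 (gt_eqF sp2) orbF.
apply: row3P; rewrite ?s2 !mxE //=.
- by apply: (z0 _ (s 0 1)); lra.
- by apply: (z0 _ (- s 0 0)); lra.
Qed.

End BaseFrame.

(** * Duality between {p,q} and {q,p} *)

Section OrderSwap.
Variable R : realType.

Definition flip_mx (A : 'M[R]_3) : 'M[R]_3 := \matrix_(i, j) A (rev_ord i) (rev_ord j).

Lemma flip_mxM A B : flip_mx (A *m B) = flip_mx A *m flip_mx B.
Proof.
apply/matrixP => i j; rewrite !mxE (reindex_inj rev_ord_inj) /=.
by apply: eq_bigr => k _; rewrite !mxE.
Qed.

Lemma flip_mx1 : flip_mx 1%:M = 1%:M.
Proof.
by apply/matrixP => i j; rewrite !mxE (inj_eq rev_ord_inj).
Qed.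

Lemma flip_simple_refl p q i :
  flip_mx (simple_refl (cox_gram R q p) i) = simple_refl (cox_gram R p q) (rev_ord i).
Proof.
apply/matrixP => j l; rewrite !mxE (inj_eq rev_ord_inj).
have -> : (i == rev_ord l) = (rev_ord i == l).
  by rewrite -(inj_eq rev_ord_inj) rev_ordK.
congr (_ - 2 * _ * _); rewrite /cox_gram -(inj_eq rev_ord_inj) rev_ordK.
by case: eqP => // _; move: i j; apply: ord3P; apply: ord3P.
Qed.

(** Reversing the order of the generators exchanges p and q, so this is [walk_order] for the dual
    mosaic. *)
Lemma rot_order p q : (3 < p)%N -> (3 < q)%N -> (4 < (p - 2) * (q - 2))%N ->
  (simple_refl (cox_gram R p q) ord_max *m simple_refl (cox_gram R p q) 1) ^+ q = 1.
Proof.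
move=> hp hq hpq.
have flipX A n : flip_mx (A ^+ n) = flip_mx A ^+ n.
  by elim: n => [|n IH]; rewrite ?flip_mx1 // !exprS -IH -[RHS]/(_ *m _) -flip_mxM.
have := congr1 flip_mx (walk_order R hq hp _); rewrite mulnC => /(_ hpq).
rewrite flipX flip_mxM !flip_simple_refl flip_mx1.
have -> : rev_ord (0 : 'I_3) = ord_max by apply: val_inj.
have -> // : rev_ord (1 : 'I_3) = 1 by apply: val_inj.
Qed.

End OrderSwap.

(** * Points attached to a frame *)

Section FrameGeometry.
Variables (R : realType) (p q : nat).
Hypotheses (hp : (3 < p)%N) (hq : (3 < q)%N) (hpq : (4 < (p - 2) * (q - 2))%N).

Local Notation K := (cox_gram R p q).
Local Notation S := (simple_refl K).
Local Notation F := (base_frame R p q).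
Local Notation T := (S 0 *m S 1).

Let K1 := cox_gram1 R p q.
Let Ksym := cox_gramC R p q.

Definition frame_vertex (N : 'M[R]_3) : 'rV[R]_3 :=
  base_vertex R p q *m invmx F *m N.
(** The midpoint of the edge up to a positive factor, which is harmless since chambers are cones. *)
Definition frame_mid (N : 'M[R]_3) : 'rV[R]_3 :=
  frame_vertex N + frame_vertex (S 0 *m N).
Definition frame_centre (N : 'M[R]_3) : 'rV[R]_3 := row3 0 0 1 *m invmx F *m N.

(** The Gram matrix does not distinguish N from - N; the last clause selects the upper sheet. *)
Definition is_frame (N : 'M[R]_3) : Prop :=
  [/\ gram K N, N \in unitmx & hyperbolic_plane (frame_vertex N)].

Let Fu : F \in unitmx. Proof. exact: base_frame_unit. Qed.
Let Fg : gram K F. Proof. exact: gram_base_frame. Qed.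

Lemma frame_vertex_base : frame_vertex F = base_vertex R p q.
Proof. by rewrite /frame_vertex mulmxKV. Qed.

Lemma is_frame_base : is_frame F.
Proof.
by split=> //; rewrite frame_vertex_base; apply: base_vertex_hyp.
Qed.

Lemma is_frame_refl i N : is_frame N -> is_frame (S i *m N).
Proof.
move=> [g u h]; split; first exact: gram_simple_refl.
  by rewrite unitmx_mul u andbT; have [] := mulmx1_unit (simple_reflK K1 i).
by rewrite /frame_vertex (mulmx_simple_refl _ _ g); apply: hyperbolic_refl => //; rewrite g K1.
Qed.

Lemma lorentz_frame_coef (a : 'rV[R]_3) N j : is_frame N ->
  lorentz (a *m invmx F *m N) (row j N) = lorentz a (row j F).
Proof.
move=> [g _ _]; rewrite !rowE (lorentz_gram2 _ _ g Fg) mulmxKV //.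
Qed.

Definition vertex_height : R := lorentz (base_vertex R p q) (row 0 F).
Definition centre_height : R := lorentz (row3 0 0 1) (row ord_max F).

Lemma vertex_height_gt0 : 0 < vertex_height.
Proof.
have [l l0 h] := lorentz_base_vertex R hp hq hpq.
by rewrite /vertex_height h mulr1.
Qed.

Lemma centre_height_gt0 : 0 < centre_height.
Proof.
have [l l0 h] := lorentz_base_centre R hp hq hpq.
by rewrite /centre_height h mulr1.
Qed.

Lemma lorentz_vertex N j : is_frame N ->
  lorentz (frame_vertex N) (row j N) = vertex_height * (j == 0)%:R.
Proof.
move=> hN; rewrite lorentz_frame_coef // /vertex_height.
have [l l0 h] := lorentz_base_vertex R hp hq hpq.
by rewrite !h eqxx mulr1.
Qed.

Lemma lorentz_centre N j : is_frame N ->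
  lorentz (frame_centre N) (row j N) = centre_height * (j == ord_max)%:R.
Proof.
move=> hN; rewrite lorentz_frame_coef // /centre_height.
have [l l0 h] := lorentz_base_centre R hp hq hpq.
by rewrite !h eqxx mulr1.
Qed.

Lemma frame_vertex_refl i N : is_frame N ->
  frame_vertex (S i *m N) = refl (row i N) (frame_vertex N).
Proof. by move=> [g _ _]; rewrite /frame_vertex (mulmx_simple_refl _ _ g). Qed.

Lemma frame_vertex_fix i N : i != 0 -> is_frame N ->
  frame_vertex (S i *m N) = frame_vertex N.
Proof.
move=> i0 hN; rewrite frame_vertex_refl // /refl lorentz_vertex // (negPf i0).
by rewrite !mulr0 scale0r subr0.
Qed.

Lemma frame_centre_fix i N : i != ord_max -> is_frame N ->
  frame_centre (S i *m N) = frame_centre N.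
Proof.
move=> i0 hN; have [g _ _] := hN.
rewrite /frame_centre (mulmx_simple_refl _ _ g) /refl -/(frame_centre N).
by rewrite lorentz_centre // (negPf i0) !mulr0 scale0r subr0.
Qed.

Lemma lorentz_mid N j : is_frame N ->
  lorentz (frame_mid N) (row j N) =
  2 * vertex_height * cos (pi / p%:R) * (j == 1)%:R.
Proof.
move=> hN; have [g _ _] := hN.
rewrite /frame_mid frame_vertex_refl // reflE !lorentzDl lorentzZl !lorentz_vertex //.
rewrite g eqxx mulr1; have [k01 _ k02] := cox_gramE R p q.
by move: j; apply: ord3P; rewrite ?K1 ?k01 ?k02 /=; ring.
Qed.

Definition mid_height : R := 2 * vertex_height * cos (pi / p%:R).

Lemma mid_height_gt0 : 0 < mid_height.
Proof.
by rewrite /mid_height !mulr_gt0 ?vertex_height_gt0 ?cos_pi_n_gt0.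
Qed.

Lemma frame_nondeg N (P : 'rV[R]_3) : is_frame N ->
  (forall j, lorentz P (row j N) = 0) -> P = 0.
Proof.
move=> [_ u _] h.
have h' z : lorentz P z = 0.
  rewrite -[z](mulmxKV u) lorentzC lorentz_mull big1 // => i _.
  by rewrite lorentzC h mulr0.
have := h' (row3 1 0 0); have := h' (row3 0 1 0); have := h' (row3 0 0 1).
rewrite /lorentz !mxE /= => h1 h2 h3.
by apply: row3P; rewrite mxE; lra.
Qed.

(** Vertex, midpoint and centre form, up to scale, the basis dual to the walls; a chamber is
    therefore the cone over these three points. *)
Lemma frame_expansion N (P : 'rV[R]_3) : is_frame N ->
  P = (lorentz P (row 0 N) / vertex_height) *: frame_vertex N +
      (lorentz P (row 1 N) / mid_height) *: frame_mid N +
      (lorentz P (row ord_max N) / centre_height) *: frame_centre N.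
Proof.
move=> hN; apply/eqP; rewrite -subr_eq0; apply/eqP.
apply: (frame_nondeg hN) => j; rewrite lorentzDl -scaleN1r lorentzZl !lorentzDl !lorentzZl.
rewrite lorentz_vertex // lorentz_mid // lorentz_centre // -/mid_height.
have v0 := lt0r_neq0 vertex_height_gt0; have m0 := lt0r_neq0 mid_height_gt0.
have c0 := lt0r_neq0 centre_height_gt0.
by move: j; apply: ord3P => /=; field; rewrite ?v0 ?m0 ?c0.
Qed.

(** Puts the centre in the cone over the vertices of its face, as [polygonE] requires. *)
Lemma frame_centre_sum N :
  frame_centre N = (p%:R * base_vertex R p q 0 ord_max)^-1 *:
    \sum_(k < p) frame_vertex (T ^+ k *m N).
Proof.
have [_ h0] := base_vertex_hyp R hp hq hpq.
have c0 : p%:R * base_vertex R p q 0 ord_max != 0.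
  by rewrite mulf_neq0 ?gt_eqF // ltr0n; lia.
have e (k : 'I_p) : frame_vertex (T ^+ k *m N) =
    base_vertex R p q *m rotz (k%:R * (2 * pi / p%:R)) *m (invmx F *m N).
  have e : T ^+ k = F *m rotz (k%:R * (2 * pi / p%:R)) *m invmx F.
    by rewrite -walk_exp_base_frame // mulmxK.
  by rewrite /frame_vertex e !mulmxA mulmxKV.
under eq_bigr => k _ do rewrite e.
rewrite -mulmx_suml sum_walk // scalemxAl /frame_centre -mulmxA; congr (_ *m _).
move: (p%:R * _) c0 => c c0; by apply: row3P; rewrite !mxE /= ?mulr0 ?mulVf.
Qed.

Definition frame_inner (N : 'M[R]_3) : 'rV[R]_3 :=
  frame_vertex N + frame_mid N + frame_centre N.

Lemma lorentz_inner N j : is_frame N -> 0 < lorentz (frame_inner N) (row j N).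
Proof.
move=> hN.
have -> : lorentz (frame_inner N) (row j N) = lorentz (frame_vertex N) (row j N) +
    lorentz (frame_mid N) (row j N) + lorentz (frame_centre N) (row j N).
  by rewrite -!lorentzDl.
rewrite lorentz_vertex // lorentz_mid // lorentz_centre //.
have v0 := vertex_height_gt0; have m0 := mid_height_gt0.
have c0 := centre_height_gt0; rewrite -/mid_height.
by move: j; apply: ord3P => /=; lra.
Qed.

Lemma frame_inner_refl i N : is_frame N ->
  frame_inner (S i *m N) = refl (row i N) (frame_inner N).
Proof.
move=> [g _ _].
pose a := base_vertex R p q *m invmx F; pose b := row3 0 0 1 *m invmx F : 'rV[R]_3.
have e M : frame_inner M = (a + (a + a *m S 0) + b) *m M.
  by rewrite !mulmxDl /frame_inner /frame_mid /frame_vertex !mulmxA.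
by rewrite !e (mulmx_simple_refl _ _ g).
Qed.

End FrameGeometry.

(** * The geometric mosaic *)

Lemma finite_card_le_eq (T : choiceType) (A B : set T) :
  finite_set B -> A `<=` B -> (B #<= A)%card -> A = B.
Proof.
move=> fB AB BA; have fA := sub_finite_set AB fB.
suff e : fset_set A = fset_set B by rewrite -(fset_setK fA) e fset_setK.
apply/eqP; rewrite eqEfcard; apply/andP; split.
  by rewrite -fset_set_sub.
have [n en] := fB; rewrite (card_fset_set en).
apply: leq_card_fset_set => //.
by move: en; rewrite card_eq_sym => /card_eqPle[en _]; exact: card_le_trans en BA.
Qed.

Section FlagOrders.
Variables (p q : nat).
Hypotheses (hp : (3 < p)%N) (hq : (3 < q)%N).

Lemma fsw_order i j : i != j -> forall x,
  iter (cox_order p q i j) (fun x => fsw hp hq j (fsw hp hq i x)) x = x.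
Proof.
have swap n i' j' : (forall x, iter n (fun x => fsw hp hq j' (fsw hp hq i' x)) x = x) ->
    forall x, iter n (fun x => fsw hp hq i' (fsw hp hq j' x)) x = x.
  move=> h x; rewrite -[x](fswK hp hq i') -[in RHS](h (fsw hp hq i' x)).
  by elim: n {h} => //= n ->.
have h10 x : iter p (fun x => fsw hp hq 0 (fsw hp hq 1 x)) x = x := face_rot hp hq x.
have h12 x : iter q (fun x => fsw hp hq ord_max (fsw hp hq 1 x)) x = x :=
  vertex_rot hp hq x.
have h02 x : iter 2 (fun x => fsw hp hq ord_max (fsw hp hq 0 x)) x = x.
  rewrite /= -[fsw hp hq ord_max]/(@fs2 p q) -[fsw hp hq 0]/(fs0 hp hq).
  by rewrite fs02C fs0K fs2K.
by move: i j; apply: ord3P; apply: ord3P => // _; rewrite /cox_order /=;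
  first [exact: h10 | exact: h12 | exact: h02
  | exact: swap h10 | exact: swap h12 | exact: swap h02].
Qed.

Lemma cox_order_gt0 (i j : 'I_3) : i != j -> (0 < cox_order p q i j)%N.
Proof.
by move: i j; apply: ord3P; apply: ord3P => // _; rewrite /cox_order /=; lia.
Qed.

End FlagOrders.

Section MosaicGeometry.
Variables (R : realType) (p q : nat).
Hypotheses (hp : (3 < p)%N) (hq : (3 < q)%N) (hpq : (4 < (p - 2) * (q - 2))%N).

Local Notation K := (cox_gram R p q).
Local Notation S := (simple_refl K).
Local Notation T := (S 0 *m S 1).
Local Notation flag := (flag p q).
Local Notation sw := (fsw hp hq).
Local Notation s0 := (fs0 hp hq).
Local Notation s1 := (fs1 hp hq).
Local Notation s2 := (@fs2 p q).
Local Notation rho := (frho hp hq).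

(** Kept abstract because two developments are needed: one from the base frame, to locate B0 among
    the cells, and one that places the root address at B0. *)
Variable Psi : flag -> 'M[R]_3.
Hypothesis Psi_sw : forall i x, Psi (sw i x) = S i *m Psi x.
Hypothesis Psi_frame : forall x, is_frame p q (Psi x).

Let K1 := cox_gram1 R p q.
Let Ksym := cox_gramC R p q.

Definition simple_root (x : flag) (i : 'I_3) : 'rV[R]_3 := row i (Psi x).
Definition vpos (x : flag) : 'rV[R]_3 := frame_vertex p q (Psi x).
Definition centre (x : flag) : 'rV[R]_3 := frame_centre p q (Psi x).
Definition inpt (x : flag) : 'rV[R]_3 := frame_inner p q (Psi x).

Definition chamber (x : flag) : set 'rV[R]_3 := [set P | forall i, 0 <= lorentz P (simple_root x i)].

Let simple_root_sw i x j : simple_root (sw i x) j = simple_root x j - (2 * K j i) *: simple_root x i.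
Proof. by rewrite /simple_root Psi_sw row_simple_refl. Qed.

(** The map f may be any invariant of the generators whose walls contain P; below it is the address,
    the face, the pair of ends of an edge, or the flag itself. *)
Lemma chambers_meet x y P : chamber x P -> chamber y P ->
  (forall i, lorentz P (simple_root x i) = lorentz P (simple_root y i)) /\
  forall (U : Type) (f : flag -> U),
    (forall i z, lorentz P (simple_root y i) = 0 -> f (sw i z) = f z) -> f x = f y.
Proof.
move=> hx hy.
exact: (chamber_unique (fswK hp hq) (fside_sw hp hq) (@fsw_ind p q hp hq)
  (cox_order_gt0 hp hq) (fsw_order hp hq) simple_root_sw K1 Ksym (cox_cheb R hp hq)
  (L := lorentz P) (fun u v => lorentzDr u v P) (fun a u => lorentzZr a u P) hy hx).
Qed.

Lemma pos_sw i x : vpos (sw i x) = refl (simple_root x i) (vpos x).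
Proof. by rewrite /vpos Psi_sw frame_vertex_refl. Qed.

Lemma pos_fs1 x : vpos (s1 x) = vpos x.
Proof. by rewrite /vpos -[s1 x]/(sw 1 x) Psi_sw frame_vertex_fix. Qed.

Lemma pos_fs2 x : vpos (s2 x) = vpos x.
Proof. by rewrite /vpos -[s2 x]/(sw ord_max x) Psi_sw frame_vertex_fix. Qed.

Lemma centre_fs0 x : centre (s0 x) = centre x.
Proof. by rewrite /centre -[s0 x]/(sw 0 x) Psi_sw frame_centre_fix. Qed.

Lemma centre_fs1 x : centre (s1 x) = centre x.
Proof. by rewrite /centre -[s1 x]/(sw 1 x) Psi_sw frame_centre_fix. Qed.

Lemma lorentz_pos x j : lorentz (vpos x) (simple_root x j) = vertex_height R p q * (j == 0)%:R.
Proof. exact: lorentz_vertex. Qed.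

Lemma lorentz_ctr x j :
  lorentz (centre x) (simple_root x j) = centre_height R p q * (j == ord_max)%:R.
Proof. exact: lorentz_centre. Qed.

Let vh0 : 0 < vertex_height R p q. Proof. exact: vertex_height_gt0. Qed.
Let ch0 : 0 < centre_height R p q. Proof. exact: centre_height_gt0. Qed.

Lemma pos_chamber x : chamber x (vpos x).
Proof. by move=> i; rewrite lorentz_pos mulr_ge0 ?ler0n ?(ltW vh0). Qed.

(** A vertex lies on walls 1 and 2 and off wall 0, and the generators 1 and 2 preserve the
    address. *)
Lemma addr_pos x y : addr x = addr y <-> vpos x = vpos y.
Proof.
split=> [e|e].
  apply: (@addr_ind p q hp hq (fun z => vpos z = vpos y) y _ _ erefl x e) => z.
    by rewrite pos_fs1.
  by rewrite pos_fs2.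
have hx := pos_chamber x; have hy := pos_chamber y; rewrite -e in hy.
have [_ ->//] := chambers_meet hx hy; rewrite e.
move=> i z; rewrite lorentz_pos; move: i; apply: ord3P => [|_|_].
- by rewrite mulr1 => h; move: vh0; rewrite h ltxx.
- exact: addr_fs1.
- exact: addr_fs2.
Qed.

Lemma pos_hyp x : hyperbolic_plane (vpos x).
Proof. by have [] := Psi_frame x. Qed.

Definition face_flag (x : flag) (k : nat) (b : bool) : flag :=
  if b then s1 (iter k rho x) else iter k rho x.

Definition sface (x y : flag) : Prop := exists k b, y = face_flag x k b.

Lemma iter_rho_mod k x : iter (k %% p) rho x = iter k rho x.
Proof.
rewrite [in RHS](divn_eq k p) addnC iterD; congr iter.
by elim: (k %/ p)%N => // n IH; rewrite mulSn iterD -IH face_rot.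
Qed.

Lemma fs0_face_flag x k b : exists k' b', s0 (face_flag x k b) = face_flag x k' b'.
Proof.
case: b; first by exists k.+1, false.
exists (k + p.-1)%N, true => /=.
rewrite -[iter k rho x in LHS]iter_rho_mod -(modnDr k p) iter_rho_mod.
have -> : (k + p = (k + p.-1).+1)%N by lia.
by rewrite iterS /frho fs0K.
Qed.

Lemma sface_fs0 x y : sface x y -> sface x (s0 y).
Proof. by move=> [k [b ->]]; have [k' [b' ->]] := fs0_face_flag x k b; exists k', b'. Qed.

Lemma sface_fs1 x y : sface x y -> sface x (s1 y).
Proof.
move=> [k [b ->]]; exists k, (~~ b).
by case: b; rewrite /= ?fs1K.
Qed.

Lemma sface_refl x : sface x x.
Proof. by exists 0%N, false. Qed.

Lemma sface_inv (U : Type) (f : flag -> U) : (forall z, f (s0 z) = f z) ->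
  (forall z, f (s1 z) = f z) -> forall x y, sface x y -> f y = f x.
Proof.
move=> f0 f1 x y [k [b ->]].
have e : f (iter k rho x) = f x by elim: k => //= k <-; rewrite /frho f0 f1.
by case: b; rewrite /= ?f1.
Qed.

Lemma sface_trans x y z : sface x y -> sface y z -> sface x z.
Proof.
move=> hxy [k [b ->]].
have h : sface x (iter k rho y).
  by elim: k => //= k IH; apply: sface_fs0; apply: sface_fs1.
by case: b => //=; apply: sface_fs1.
Qed.

Lemma sface_sym x y : sface x y -> sface y x.
Proof.
move=> h; have <- : sface y y = sface y x; last exact: sface_refl.
apply: (sface_inv (f := sface y)) h => z; apply/propext; split=> h.
- by rewrite -[z](fs0K hp hq); apply: sface_fs0.
- exact: sface_fs0.
- by rewrite -[z](fs1K hp hq); apply: sface_fs1.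
- exact: sface_fs1.
Qed.

Lemma sface_flevel x y : sface x y -> flevel y = flevel x.
Proof. by apply: sface_inv => z; [exact: flevel_fs0 | exact: flevel_fs1]. Qed.

Lemma sface_centre x y : sface x y -> centre y = centre x.
Proof. by apply: sface_inv; [exact: centre_fs0 | exact: centre_fs1]. Qed.

(** Convexity of a face. The root of y is a combination of the roots of x with coefficients of one
    sign, and the common centre, on which it is positive, decides that sign. *)
Lemma face_side x y : centre x = centre y -> 0 <= lorentz (vpos x) (simple_root y ord_max).
Proof.
move=> e.
have sgn := root_sign (fswK hp hq) (fside_sw hp hq) (@fsw_ind p q hp hq)
  (cox_order_gt0 hp hq) (fsw_order hp hq) simple_root_sw K1 Ksym (cox_cheb R hp hq) x y ord_max.
have posE (c : 'I_3 -> R) :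
    lorentz (vpos x) (\sum_j c j *: simple_root x j) = vertex_height R p q * c 0.
  by rewrite lorentzC lorentz_suml sum_ord3 !lorentzZl !(lorentzC _ (vpos x)) !lorentz_pos /=; ring.
have ctrE (c : 'I_3 -> R) :
    lorentz (centre x) (\sum_j c j *: simple_root x j) = centre_height R p q * c ord_max.
  by rewrite lorentzC lorentz_suml sum_ord3 !lorentzZl !(lorentzC _ (centre x)) !lorentz_ctr /=; ring.
have hc : lorentz (centre x) (simple_root y ord_max) = centre_height R p q.
  by rewrite e lorentz_ctr mulr1.
case: sgn => -[c c0 ec]; first by rewrite ec posE mulr_ge0 // ltW.
exfalso; have : lorentz (centre x) (- simple_root y ord_max) = - centre_height R p q.
  by rewrite -scaleN1r lorentzZr hc mulN1r.
rewrite ec ctrE => h.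
have : 0 <= centre_height R p q * c ord_max by rewrite mulr_ge0 // ltW.
by rewrite h oppr_ge0 leNgt ch0.
Qed.

Lemma inpt_sw i x : inpt (sw i x) = refl (simple_root x i) (inpt x).
Proof. by rewrite /inpt Psi_sw frame_inner_refl. Qed.

Lemma lorentz_inpt x i : 0 < lorentz (inpt x) (simple_root x i).
Proof. exact: lorentz_inner. Qed.

(** Among the finitely many chambers of the dihedral orbit, take one whose inner point has the
    largest form with P (the nearest one, for P in the plane). If P were beyond wall i or j,
    reflecting in that wall would increase the form. *)
Lemma dihedral_max (i j : 'I_3) (m : nat) (x : flag) (P : 'rV[R]_3) : (0 < m)%N ->
  (forall x, iter m (fun x => sw i (sw j x)) x = x) ->
  exists (k : nat) (b : bool),
    let y := iter k (fun x => sw i (sw j x)) x in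
    let z := if b then sw j y else y in
    [/\ (k < m)%N, 0 <= lorentz P (simple_root z i) & 0 <= lorentz P (simple_root z j)].
Proof.
move=> m0 hm; pose r x := sw i (sw j x).
pose g (kb : 'I_m * bool) := let y := iter kb.1 r x in if kb.2 then sw j y else y.
have gmod k b : exists kb, g kb = if b then sw j (iter k r x) else iter k r x.
  exists (Ordinal (ltn_pmod k m0), b); rewrite /g /=.
  suff -> : iter (k %% m) r x = iter k r x by [].
  rewrite [in RHS](divn_eq k m) addnC iterD; congr iter.
  by elim: (k %/ m)%N => // n IH; rewrite mulSn iterD -IH hm.
have gj kb : exists kb', g kb' = sw j (g kb).
  case: kb => k b; have [kb' e] := gmod k (~~ b); exists kb'; rewrite e /g /=.
  by case: (b); rewrite /= ?fswK.
have gi kb : exists kb', g kb' = sw i (g kb).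
  case: kb => k [].
    by have [kb' e] := gmod k.+1 false; exists kb'; rewrite e /g.
  have [kb' e] := gmod (k + m.-1)%N true; exists kb'; rewrite e /g /=.
  have -> : iter k r x = iter (k + m) r x by rewrite iterD hm.
  have -> : (k + m = (k + m.-1).+1)%N by lia.
  by rewrite iterS /r fswK.
pose f kb := lorentz P (inpt (g kb)).
pose kb0 : 'I_m * bool := (Ordinal m0, false).
have [kb hkb] : exists kb, forall kb', f kb' <= f kb.
  exists [arg max_(kb > kb0) f kb]%O; case: arg_maxP => // kb _ h kb'; exact: h.
have side l : (exists kb', g kb' = sw l (g kb)) -> 0 <= lorentz P (simple_root (g kb) l).
  move=> [kb' e]; have := hkb kb'; rewrite /f e inpt_sw reflE lorentzDr lorentzZr.
  have := lorentz_inpt (g kb) l.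
  move: (lorentz _ _) (lorentz P (simple_root _ _)) (lorentz P (inpt _)) => a b c.
  by rewrite gerDl !mulNr oppr_le0 => a0; rewrite -mulrA !pmulr_rge0.
exists kb.1, kb.2; split; [by case: kb.1|exact: side|exact: side].
Qed.

Definition matches (c : 'I_p -> 'rV[R]_3) (x : flag) : Prop :=
  forall k : 'I_p, c k = vpos (iter k rho x).

Definition cell_set (x : flag) : set 'rV[R]_3 :=
  [set P | hyperbolic_plane P /\ exists2 y, sface x y & chamber y P].

Lemma cell_set_sface x y : sface x y -> cell_set x = cell_set y.
Proof.
move=> h; apply/seteqP; split=> P [hP [z hz hc]]; split => //; exists z => //.
  exact: sface_trans (sface_sym h) hz.
exact: sface_trans h hz.
Qed.

Lemma Psi_iter k x : Psi (iter k rho x) = T ^+ k *m Psi x.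
Proof.
elim: k => [|k IH]; first by rewrite expr0 mul1mx.
rewrite iterS /frho -[s0 _]/(sw 0 (sw 1 (iter k rho x))) !Psi_sw IH.
by rewrite exprS -[_ * _]/(_ *m _) !mulmxA.
Qed.

Lemma pos_face_flag x k b : exists k' : 'I_p, vpos (face_flag x k b) = vpos (iter k' rho x).
Proof.
have kp : (k %% p < p)%N by rewrite ltn_mod; lia.
exists (Ordinal kp); rewrite /= iter_rho_mod.
by case: b; rewrite /= ?pos_fs1.
Qed.

Lemma centreE x : centre x = (p%:R * base_vertex R p q 0 ord_max)^-1 *:
  \sum_(k < p) vpos (iter k rho x).
Proof.
rewrite /centre frame_centre_sum //; congr (_ *: _).
by apply: eq_bigr => k _; rewrite /vpos Psi_iter.
Qed.

(** A point of the polygon satisfies the inequality of every side by [face_side], and [dihedral_max]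
    finds its chamber around the centre. Conversely a chamber is spanned by its vertex, midpoint and
    centre, all in the cone over the vertices. *)
Lemma polygonE c x : matches c x -> polygon c = cell_set x.
Proof.
move=> hc; apply/seteqP; split=> P [hP hl]; split=> //.
  move: hl => [l l0 eP].
  have [|k [b [_ h0 h1]]] := @dihedral_max 0 1 p x P _ (face_rot hp hq); first lia.
  exists (face_flag x k b); first by exists k, b.
  apply: ord3P; [exact: h0 | exact: h1 |].
  rewrite eP lorentz_suml sumr_ge0 // => j _; rewrite lorentzZl mulr_ge0 // hc.
  apply: face_side; rewrite (@sface_centre x _) ?(@sface_centre x (face_flag x k b)) //.
    by exists k, b.
  by exists j, false.
move: hl => [y [k [b ey]] hy].
pose cone (Q : 'rV[R]_3) := exists2 l : 'I_p -> R, (forall k, 0 <= l k) & Q = \sum_k l k *: c k.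
have cD Q1 Q2 : cone Q1 -> cone Q2 -> cone (Q1 + Q2).
  move=> [l l0 ->] [l' l'0 ->]; exists (fun k => l k + l' k) => [j|].
    by rewrite addr_ge0.
  by rewrite -big_split; apply: eq_bigr => j _; rewrite scalerDl.
have cZ a Q : 0 <= a -> cone Q -> cone (a *: Q).
  move=> a0 [l l0 ->]; exists (fun k => a * l k) => [j|]; first exact: mulr_ge0.
  by rewrite scaler_sumr; apply: eq_bigr => j _; rewrite scalerA.
have cv (k' : 'I_p) : cone (c k').
  exists (fun j => (j == k')%:R) => [j|]; first by rewrite ler0n.
  rewrite (bigD1 k') //= eqxx scale1r big1 ?addr0 // => j /negPf ->.
  by rewrite scale0r.
have cpos k' b' : cone (vpos (face_flag x k' b')).
  by have [j ->] := pos_face_flag x k' b'; rewrite -hc.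
have cmid : cone (frame_mid p q (Psi y)).
  rewrite /frame_mid -(Psi_sw 0) -/(vpos y) -/(vpos (sw 0 y)); apply: cD.
    by rewrite ey.
  by rewrite ey; have [k' [b' e]] := fs0_face_flag x k b; rewrite -[sw 0 _]/(s0 _) e.
have cctr : cone (centre y).
  rewrite (@sface_centre x y); last by exists k, b.
  rewrite centreE; apply: cZ.
    have [_ h0] := base_vertex_hyp R hp hq hpq.
    by rewrite invr_ge0 mulr_ge0 // ltW.
  by exists (fun=> 1) => // ; apply: eq_bigr => j _; rewrite scale1r hc.
rewrite -/(cone P) (frame_expansion hp hq hpq P (Psi_frame y)).
have mh0 := mid_height_gt0 R hp hq hpq.
rewrite -/(cone _); apply: (cD _ _ (cD _ _ _ _)); apply: (cZ _ _);
  rewrite ?divr_ge0 ?(ltW vh0) ?(ltW mh0) ?(ltW ch0) ?hy //.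
by rewrite -/(vpos y) ey.
Qed.

(** * Reflections in the sides of a cell *)

Lemma line_normal_orth (u w : 'rV[R]_3) :
  lorentz (line_normal u w) u = 0 /\ lorentz (line_normal u w) w = 0.
Proof. by rewrite /lorentz !mxE /=; split; ring. Qed.

Lemma line_normal_norm (u w : 'rV[R]_3) :
  lorentz (line_normal u w) (line_normal u w) =
  lorentz u w ^+ 2 - lorentz u u * lorentz w w.
Proof. by rewrite /lorentz !mxE /=; ring. Qed.

Lemma reflection_l (u w : 'rV[R]_3) : reflection u w u = u.
Proof.
by rewrite /reflection lorentzC (line_normal_orth u w).1 mulr0 mul0r scale0r subr0.
Qed.

Lemma reflection_r (u w : 'rV[R]_3) : reflection u w w = w.
Proof.
by rewrite /reflection lorentzC (line_normal_orth u w).2 mulr0 mul0r scale0r subr0.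
Qed.

(* If [u] and [w] span no line, division by 0 makes the reflection the identity. *)
Lemma reflectionK (u w : 'rV[R]_3) : involutive (reflection u w).
Proof.
move=> z; rewrite /reflection; set n := line_normal u w.
set t := 2 * lorentz z n / lorentz n n.
have -> : lorentz (z - t *: n) n = lorentz z n - t * lorentz n n.
  by rewrite -scaleNr lorentzDl lorentzZl mulNr.
rewrite {}/t; have [->|n0] := eqVneq (lorentz n n) 0.
  by rewrite invr0 !mulr0 !scale0r !subr0.
rewrite divfK //; set a := lorentz z n.
have -> : 2 * (a - 2 * a) / lorentz n n = - (2 * a / lorentz n n) by field.
by rewrite scaleNr opprK subrK.
Qed.

(** Both ends of the edge lie on wall [ord_max], so [line_normal] is a nonzero multiple of its
    root. *)
Lemma reflection_edge y (z : 'rV[R]_3) :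
  reflection (vpos y) (vpos (s0 y)) z = refl (simple_root y ord_max) z.
Proof.
rewrite /reflection; set u := vpos y; set w := vpos (s0 y); set n := line_normal u w.
have [nu nw] := line_normal_orth u w; rewrite -/n in nu nw.
have ew : w = u + (- 2 * vertex_height R p q) *: simple_root y 0.
  by rewrite /w -[s0 y]/(sw 0 y) pos_sw reflE lorentz_pos mulr1.
have uu : lorentz u u = -1 by have [] := pos_hyp y.
have uw : lorentz u w = -1 - 2 * vertex_height R p q ^+ 2.
  by rewrite ew lorentzDr lorentzZr uu lorentz_pos /=; ring.
have ww : lorentz w w = -1 by have [] := pos_hyp (s0 y).
have n0 : lorentz n (simple_root y 0) = 0.
  have : lorentz n w = 0 by [].
  rewrite ew lorentzDr nu lorentzZr add0r => /eqP.
  by rewrite mulf_eq0 mulNr oppr_eq0 mulf_eq0 pnatr_eq0 (gt_eqF vh0) => /eqP.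
have [g _ _] := Psi_frame y.
have [_ k12 k02] := cox_gramE R p q.
set t := lorentz n (simple_root y ord_max).
have mu : lorentz (frame_mid p q (Psi y)) u = - 2 - 2 * vertex_height R p q ^+ 2.
  rewrite /frame_mid -(Psi_sw 0) -/(vpos y) -/(vpos (sw 0 y)) lorentzDl -/u uu.
  by rewrite lorentzC -[sw 0 y]/(s0 y) uw; ring.
have en : n = t *: simple_root y ord_max.
  apply/eqP; rewrite -subr_eq0; apply/eqP; apply: (frame_nondeg (Psi_frame y)) => j.
  rewrite lorentzDl -scaleNr lorentzZl -/(simple_root y j).
  have g2 j' : lorentz (simple_root y ord_max) (simple_root y j') = K ord_max j' := g _ _.
  move: j; apply: ord3P; rewrite g2.
  - by rewrite n0 Ksym k02 mulr0 addr0.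
  - have mh0 := mid_height_gt0 R hp hq hpq.
    have L3 a b c (v1 v2 v3 v4 : 'rV[R]_3) :
        lorentz (a *: v1 + b *: v2 + c *: v3) v4 =
        a * lorentz v1 v4 + b * lorentz v2 v4 + c * lorentz v3 v4.
      by rewrite !lorentzDl !lorentzZl.
    (* Pairing the expansion of v with u gives a linear relation between the three wall coordinates.
       Both n and the root are orthogonal to u and to root 0, so coordinate [ord_max] determines
       coordinate 1, as the midpoint is not orthogonal to u. *)
    have E v : lorentz v u = lorentz v (simple_root y 0) / vertex_height R p q * (-1) +
        lorentz v (simple_root y 1) / mid_height R p q * lorentz (frame_mid p q (Psi y)) u +
        lorentz v (simple_root y ord_max) / centre_height R p q * lorentz (centre y) u.
      by rewrite {1}(frame_expansion hp hq hpq v (Psi_frame y)) L3 -/(vpos y) uu.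
    have := E n; rewrite nu n0 mul0r mul0r add0r -/t => En.
    have := E (simple_root y ord_max); rewrite lorentzC lorentz_pos mulr0 !g2 K1 (Ksym ord_max 0) k02.
    rewrite mul0r mul0r add0r => Er.
    have : (lorentz n (simple_root y 1) - t * K ord_max 1) *
        (lorentz (frame_mid p q (Psi y)) u / mid_height R p q) = 0.
      have -> : (lorentz n (simple_root y 1) - t * K ord_max 1) *
        (lorentz (frame_mid p q (Psi y)) u / mid_height R p q) =
        (lorentz n (simple_root y 1) / mid_height R p q * lorentz (frame_mid p q (Psi y)) u +
         t / centre_height R p q * lorentz (centre y) u) -
        t * (K ord_max 1 / mid_height R p q * lorentz (frame_mid p q (Psi y)) u +
         1 / centre_height R p q * lorentz (centre y) u) by ring.
      by rewrite -En -Er; ring.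
    move/eqP; rewrite mulf_eq0 => /orP[/eqP h|]; first by rewrite mulNr.
    rewrite mulf_eq0 invr_eq0 (gt_eqF mh0) orbF mu => /eqP h.
    exfalso; have := sqr_ge0 (vertex_height R p q); lra.
  - by rewrite K1 mulr1 -/t addrN.
have nn : lorentz n n = t ^+ 2.
  by rewrite en lorentzZl lorentzZr g K1; ring.
have t0 : t != 0.
  apply/eqP => t0; have := line_normal_norm u w; rewrite -/n nn t0 uu ww uw.
  have : 0 < vertex_height R p q ^+ 2 by rewrite exprn_gt0.
  move: (_ ^+ 2) => v v0; rewrite expr2 mul0r => h.
  have : 0 < v * v by rewrite mulr_gt0.
  by move: h; rewrite expr2; lra.
rewrite nn en lorentzZr /refl scalerA; congr (_ - _ *: _).
by field.
Qed.

(** The matrix of a path acts in frame coordinates, so starting the path across wall [ord_max]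
    mirrors its end. *)
Lemma word_refl (f : flag -> flag) (A : 'M[R]_3) y :
  (forall z, Psi (f z) = A *m Psi z) ->
  vpos (f (s2 y)) = refl (simple_root y ord_max) (vpos (f y)).
Proof.
move=> hf; have [g _ _] := Psi_frame y.
rewrite /vpos !hf -[s2 y]/(sw ord_max y) Psi_sw /frame_vertex !(mulmxA _ A).
by rewrite (mulmx_simple_refl _ _ g).
Qed.

(** Go to side k, cross it, and walk on p - k steps to the vertex with label 0; from there the
    mirrored labels are read in order. *)
Definition reflect_flag (x : flag) (k : nat) : flag :=
  iter (p - k) rho (s1 (s2 (s1 (iter k rho x)))).

Lemma matches_reflect c x (k : 'I_p) : matches c x ->
  matches (fun j => reflection (c k) (c (ordS k)) (c j)) (reflect_flag x k).
Proof.
move=> hc j; set y := s1 (iter k rho x).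
have -> : c k = vpos y by rewrite hc /y pos_fs1.
have -> : c (ordS k) = vpos (s0 y).
  by rewrite hc /= iter_rho_mod.
rewrite reflection_edge hc.
pose f z := iter j rho (iter (p - k) rho (s1 z)).
have -> : iter j rho x = f y.
  by rewrite /f /y fs1K -(iterD (p - k) k) subnK ?face_rot // ltnW.
rewrite -[reflect_flag x k]/(iter (p - k) rho (s1 (s2 y))) -[RHS]/(vpos (f (s2 y))).
rewrite (@word_refl f (T ^+ j *m (T ^+ (p - k) *m S 1))) // => z.
by rewrite /f !Psi_iter -[s1 z]/(sw 1 z) Psi_sw !mulmxA.
Qed.

Lemma sface_reflect x k : (k <= p)%N -> sface (reflect_flag x k) (s2 (face_flag x k true)).
Proof.
move=> hk; apply: sface_sym; apply: (@sface_trans _ (s1 (s2 (face_flag x k true)))).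
  by apply: sface_fs1; apply: sface_refl.
by exists (p - k)%N, false.
Qed.

Variables (c0 : 'I_p -> 'rV[R]_3) (x0 : flag).
Hypotheses (c0_cell : @cell_vertices R p q c0) (c0_matches : matches c0 x0).

(** The inductive cells start at [base_cell] while the known match is at c0. Reflections in sides
    are involutive, so a match passes both ways: back from c0 to [base_cell], then out to c. *)
Lemma cell_vertices_matches c : @cell_vertices R p q c -> exists x, matches c x.
Proof.
pose Q c := exists x, matches c x.
have up c' k : Q c' -> Q (fun j => reflection (c' k) (c' (ordS k)) (c' j)).
  by move=> [x hx]; exists (reflect_flag x k); apply: matches_reflect.
have iff c' k : Q (fun j => reflection (c' k) (c' (ordS k)) (c' j)) <-> Q c'.
  split; last exact: up.
  move=> /(up _ k); rewrite reflection_l reflection_r.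
  by rewrite (_ : (fun j => _) = c') //; apply/funext => j; rewrite reflectionK.
have base c' : @cell_vertices R p q c' -> Q c' <-> Q (@base_cell R p q).
  by elim=> [//|c1 k _ IH]; rewrite iff.
by move=> hc; apply/(base _ hc)/(base _ c0_cell); exists x0.
Qed.

Lemma matches_cell x : exists c, @cell_vertices R p q c /\
  exists2 y, matches c y & sface y x.
Proof.
move: x; apply: (@fsw_ind p q hp hq _ x0); last first.
  by exists c0; split => //; exists x0 => //; exact: sface_refl.
apply: ord3P => x [c [hc [y hy hx]]].
- by exists c; split => //; exists y => //; exact: sface_fs0.
- by exists c; split => //; exists y => //; exact: sface_fs1.
have across x' : sface y x' -> (exists k : 'I_p, x' = face_flag y k true) ->
    exists c, @cell_vertices R p q c /\ exists2 y, matches c y & sface y (s2 x').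
  move=> _ [k ->]; exists (fun j => reflection (c k) (c (ordS k)) (c j)).
  split; first exact: cell_reflect.
  exists (reflect_flag y k); first exact: matches_reflect.
  by apply: sface_reflect; exact: ltnW.
have flagk k b : exists k' : 'I_p, face_flag y k b = face_flag y k' b.
  have kp : (k %% p < p)%N by rewrite ltn_mod; lia.
  by exists (Ordinal kp); rewrite /face_flag /= iter_rho_mod.
rewrite -[sw ord_max x]/(s2 x).
case: (hx) => k [[] ex]; first by apply: across => //; rewrite ex; apply: flagk.
have e : exists k' : 'I_p, s0 x = face_flag y k' true.
  rewrite ex; have -> : face_flag y k false = face_flag y (k + p) false.
    by rewrite /face_flag iterD face_rot.
  have [k' ek] := flagk (k + p.-1)%N true; exists k'; rewrite -ek /=.
  have -> : (k + p = (k + p.-1).+1)%N by lia.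
  by rewrite iterS /frho fs0K.
have [c1 [h1 [y1 h2 h3]]] := across _ (sface_fs0 hx) e.
exists c1; split => //; exists y1 => //.
by rewrite -[s2 x](fs0K hp hq) fs02C; apply: sface_fs0.
Qed.

Lemma cellE C : @cell R p q C <-> exists x, C = cell_set x.
Proof.
split=> [[c hc ->]|[x ->]].
  by have [x hx] := cell_vertices_matches hc; exists x; apply: polygonE.
have [c [hc [y hy hx]]] := matches_cell x; exists c => //.
by rewrite (polygonE hy); apply: cell_set_sface; apply: sface_sym.
Qed.

Lemma mosaic_vertexE v : @mosaic_vertex R p q v <-> exists x, v = vpos x.
Proof.
split=> [[c hc [k ->]]|[x ->]].
  have [x hx] := cell_vertices_matches hc; by exists (iter k rho x).
have [c [hc [y hy [k [b ->]]]]] := matches_cell x; exists c => //.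
by have [k' ->] := pos_face_flag y k b; exists k'; rewrite hy.
Qed.

Lemma mosaic_edgeE u v : @mosaic_edge R p q u v <->
  exists x, u = vpos x /\ v = vpos (s0 x).
Proof.
have edge c x (k : 'I_p) : matches c x ->
    c k = vpos (face_flag x k true) /\ c (ordS k) = vpos (s0 (face_flag x k true)).
  by move=> hx; rewrite !hx /= pos_fs1 iter_rho_mod.
split=> [[c hc [k h]]|[x [-> ->]]].
  have [x hx] := cell_vertices_matches hc; have [e1 e2] := edge _ _ k hx.
  case: h => -[-> ->]; first by exists (face_flag x k true).
  by exists (s0 (face_flag x k true)); rewrite fs0K.
have [c [hc [y hy hx]]] := matches_cell x; exists c => //.
have flagk k b : exists k' : 'I_p, face_flag y k b = face_flag y k' b.
  have kp : (k %% p < p)%N by rewrite ltn_mod; lia.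
  by exists (Ordinal kp); rewrite /face_flag /= iter_rho_mod.
case: hx => k [[] ->]; have [k' e] := flagk k true.
  by exists k'; left; rewrite e; have [-> ->] := edge _ _ k' hy.
have e' : exists k' : 'I_p, s0 (face_flag y k false) = face_flag y k' true.
  have -> : face_flag y k false = face_flag y (k + p) false.
    by rewrite /face_flag iterD face_rot.
  have [k1 ek] := flagk (k + p.-1)%N true; exists k1; rewrite -ek /=.
  have -> : (k + p = (k + p.-1).+1)%N by lia.
  by rewrite iterS /frho fs0K.
have [k1 e1] := e'; exists k1; right.
by have [-> ->] := edge _ _ k1 hy; rewrite -e1 fs0K.
Qed.

(** * Belts and levels *)

Lemma vertex_in_cell x y : sface x y -> cell_set x (vpos y).
Proof. by move=> h; split; [exact: pos_hyp | exists y => //; exact: pos_chamber]. Qed.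

(** Belts are defined by common points; this provides a common vertex. The walls through P decide:
    off wall 0 the vertex agrees, off wall [ord_max] the whole face, off wall 1 the pair of ends of
    the edge; P on all three walls would be 0. *)
Lemma cell_sets_meet x y P : cell_set x P -> cell_set y P ->
  exists x' y', [/\ sface x x', sface y y' & addr x' = addr y'].
Proof.
move=> [hP [x1 hx cx]] [_ [y1 hy cy]]; have [_ inv] := chambers_meet cx cy.
have [v0|v0] := eqVneq (lorentz P (simple_root y1 0)) 0; last first.
  exists x1, y1; split => //; apply: inv => i z.
  move: i; apply: ord3P => [h|_|_]; [by rewrite h eqxx in v0|exact: addr_fs1|exact: addr_fs2].
have [v2|v2] := eqVneq (lorentz P (simple_root y1 ord_max)) 0; last first.
  have h : sface y x1 = sface y y1.
    apply: inv => i z; move: i; apply: ord3P => [_|_|h]; last by rewrite h eqxx in v2.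
      apply/propext; split=> h; last exact: sface_fs0.
      by rewrite -[z](fs0K hp hq); apply: sface_fs0.
    apply/propext; split=> h; last exact: sface_fs1.
    by rewrite -[z](fs1K hp hq); apply: sface_fs1.
  by exists x1, x1; split => //; rewrite h.
have [v1|v1] := eqVneq (lorentz P (simple_root y1 1)) 0.
  have P0 : P = 0.
    by apply: (frame_nondeg (Psi_frame y1)) => j; move: j; apply: ord3P.
  by move: hP => [_]; rewrite P0 mxE ltxx.
have : [set addr x1; addr (s0 x1)] = [set addr y1; addr (s0 y1)].
  apply: (inv _ (fun z => [set addr z; addr (s0 z)])) => i z.
  move: i; apply: ord3P => [_|h|_]; last by rewrite -[sw ord_max z]/(s2 z) fs02C.
    by rewrite -[sw 0 z]/(s0 z) fs0K setUC.
  by rewrite h eqxx in v1.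
move/seteqP => [/(_ (addr x1) (or_introl erefl)) h _].
case: h => h; first by exists x1, y1.
by exists x1, (s0 y1); split => //; apply: sface_fs0.
Qed.

Lemma flevel_addr x y : sface x y ->
  (flevel x <= size (addr y) <= (flevel x).+1)%N.
Proof. by move=> /sface_flevel <-; exact: (size_addr hp hq). Qed.

Lemma bottom_face x : exists2 y, sface x y & size (addr y) = flevel x.
Proof. by have [n h] := bottom_vertex hp hq x; exists (iter n rho x) => //; exists n, false. Qed.

Variables (B0 : 'rV[R]_3) (r : flag).
Hypotheses (r_root : addr r = [::]) (B0E : B0 = vpos r).

Lemma flevel_root : flevel r = 0%N.
Proof. by have := flevel_addr (sface_refl r); rewrite r_root /=; case: (flevel r). Qed.

Lemma root_cell x : cell_set x B0 <-> flevel x = 0%N.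
Proof.
rewrite B0E; split=> [h|h].
  have [x' [y' [hx hy e]]] := cell_sets_meet h (vertex_in_cell (sface_refl r)).
  have [_ [x1 h1 c1]] := h; have [_ inv] := chambers_meet c1 (pos_chamber r).
  have : addr x1 = addr r.
    apply: inv => i z; rewrite lorentz_pos; move: i; apply: ord3P => [|_|_].
    - by rewrite mulr1 => h0; move: vh0; rewrite h0 ltxx.
    - exact: addr_fs1.
    - exact: addr_fs2.
  by have := flevel_addr h1; rewrite r_root => /[swap] ->; case: (flevel x).
have [y hy sy] := bottom_face x.
have -> : vpos r = vpos y.
  by apply/addr_pos; rewrite r_root; move: sy; rewrite h => /size0nil.
exact: vertex_in_cell.
Qed.

Local Notation belt := (@belt R p q B0).

Lemma beltS j : belt j.+2 = [set C | [/\ @cell R p q C,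
  C `&` region (belt j.+1) !=set0 & C `&` region (belt j) = set0]].
Proof. by []. Qed.

(** A cell meeting a face of level j has level j - 1, j or j + 1. Level j is excluded because its
    bottom vertex already lies in the preceding belt, level j - 1 because the cell would itself
    belong there. Belt 0 is a point rather than faces, hence the separate case. *)
Lemma beltE i : belt i.+1 = [set C | exists2 x, flevel x = i & C = cell_set x].
Proof.
pose Q i := belt i.+1 = [set C | exists2 x, flevel x = i & C = cell_set x].
suff : Q i /\ Q i.+1 by case.
have Q0 : Q 0%N.
  apply/seteqP; split=> C /=.
    move=> [/cellE [x ->]] [P [hP /= eP]]; exists x => //.
    by apply/root_cell; rewrite -eP.
  move=> [x h ->]; split; first by apply/cellE; exists x.
  by exists B0; split => //=; apply/root_cell.
have step j : Q j -> (j = 0%N \/ exists2 j', j = j'.+1 & Q j') -> Q j.+1.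
  move=> hj hj'; rewrite /Q beltS; apply/seteqP; split=> C.
    move=> [/cellE [x ->] [P [hP [D hD hDP]]] h3]; exists x => //.
    move: hD; rewrite hj => -[y ly eD]; rewrite eD in hDP.
    have [x' [y' [hx hy exy]]] := cell_sets_meet hP hDP.
    have sx := flevel_addr hx; have sy := flevel_addr hy; rewrite exy ly in sx sy.
    have nj : flevel x <> j.
      move=> lx; have [z hz sz] := bottom_face x; rewrite lx in sz.
      have hcz := vertex_in_cell hz.
      case: hj' => [j0|[j' ej Qj']].
        rewrite j0 in sz lx h3; have e : vpos z = B0.
          by rewrite B0E; apply/addr_pos; rewrite r_root; exact: size0nil.
        suff : (cell_set x `&` region (belt 0)) B0 by rewrite h3.
        by split; [apply/root_cell | exists [set B0]].
      have [|y2 e2 l2] := inner_face hp hq (x := z); first by move=> e; rewrite e ej in sz.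
      rewrite sz ej in l2; case: l2 => l2.
      suff : (cell_set x `&` region (belt j)) (vpos z) by rewrite h3.
      split => //; exists (cell_set y2); first by rewrite ej Qj'; exists y2.
      by have /addr_pos -> := esym e2; exact: vertex_in_cell (sface_refl _).
    have nj1 : flevel x <> j.-1 \/ j = 0%N.
      case: hj' => [->|[j' ej Qj']]; [by right|left=> lx].
      suff : (cell_set x `&` region (belt j)) (vpos x) by rewrite h3.
      have hx0 := vertex_in_cell (sface_refl x).
      split => //; exists (cell_set x) => //.
      by rewrite ej Qj'; exists x => //; rewrite lx ej.
    lia.
  move=> [x lx ->]; split; first by apply/cellE; exists x.
    have [z hz sz] := bottom_face x; rewrite lx in sz.
    have [|y ey ly] := inner_face hp hq (x := z); first by move=> e; rewrite e in sz.
    exists (vpos z); split; first exact: vertex_in_cell.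
    exists (cell_set y); first by rewrite hj; exists y => //; rewrite sz in ly; case: ly.
    by have /addr_pos -> := esym ey; exact: vertex_in_cell (sface_refl _).
  apply/seteqP; split => // P [hP [D hD hDP]].
  case: hj' => [j0|[j' ej Qj']].
    rewrite j0 /= in hD; rewrite hD /= in hDP; rewrite hDP in hP.
    by move/root_cell: hP; rewrite lx.
  move: hD; rewrite ej Qj' => -[y ly eD]; rewrite eD in hDP.
  have [x' [y' [hx hy exy]]] := cell_sets_meet hP hDP.
  have := flevel_addr hx; have := flevel_addr hy; rewrite exy lx ly ej; lia.
elim: i => [|i [IH1 IH2]]; first by split=> //; apply: step => //; left.
by split=> //; apply: step => //; right; exists i.
Qed.

Lemma belts_regionE i P :
  (\bigcup_(j in [set j | (j <= i.+1)%N]) region (belt j)) P <->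
  exists2 x, (flevel x <= i)%N & cell_set x P.
Proof.
split=> [[[|j] hj]|[x lx hx]].
- move=> [D -> /= ->]; exists r; first by rewrite flevel_root.
  by apply/root_cell; exact: flevel_root.
- by move=> [D]; rewrite beltE => -[x lx ->] hx; exists x => //; rewrite lx.
- exists (flevel x).+1; [exact: lx | exists (cell_set x) => //].
  by rewrite beltE; exists x.
Qed.

(** * Boundaries near a vertex *)

Lemma continuous_lorentz (v : 'rV[R]_3) : continuous (fun P : 'rV[R]_3 => lorentz P v).
Proof.
move=> P; have h i j : (fun Q : 'rV[R]_3 => Q i j * v i j) @ P --> P i j * v i j.
  have c : (fun Q : 'rV[R]_3 => Q i j) @ P --> P i j by exact: coord_continuous.
  exact: cvgMr_tmp c.
exact: cvgB (cvgD (h _ _) (h _ _)) (h _ _).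
Qed.

(** Near the vertex, wall 0 of the surrounding chambers stays strictly positive by continuity;
    [dihedral_max] settles walls 1 and [ord_max]. *)
Lemma star_nbhs x : \forall P \near vpos x,
  exists y, [/\ addr y = addr x, chamber y P & 0 < lorentz P (simple_root y 0)].
Proof.
pose z (kb : 'I_q * bool) := let y := iter kb.1 (fun x => s2 (s1 x)) x in
  if kb.2 then s1 y else y.
have az kb : addr (z kb) = addr x.
  rewrite /z; have e k : addr (iter k (fun x => s2 (s1 x)) x) = addr x.
    by elim: k => //= k; rewrite addr_fs2 addr_fs1.
  by case: kb.2; rewrite ?addr_fs1 e.
have h : \forall P \near vpos x, forall kb, 0 < lorentz P (simple_root (z kb) 0).
  apply: (@filter_forall _ ('I_q * bool)%type (fun kb P => 0 < lorentz P (simple_root (z kb) 0))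
    (nbhs (vpos x)) (nbhs_filter _)) => kb.
  have h0 : lorentz (vpos x) (simple_root (z kb) 0) > 0.
    by have /addr_pos <- := az kb; rewrite lorentz_pos mulr1.
  have c : (fun P => lorentz P (simple_root (z kb) 0)) @ vpos x -->
      lorentz (vpos x) (simple_root (z kb) 0) by exact: continuous_lorentz.
  exact: (cvgr_gt _ c _ h0).
near=> P; have hP : forall kb, 0 < lorentz P (simple_root (z kb) 0) by near: P.
have [|k [b [hk h2 h1]]] := @dihedral_max ord_max 1 q x P _ (vertex_rot hp hq); first lia.
exists (z (Ordinal hk, b)); split; [exact: az| |exact: hP].
by apply: ord3P; [exact: ltW (hP _) | exact: h1 | exact: h2].
Unshelve. all: by end_near.
Qed.

(* Points of the open chamber of y converging to its vertex, rescaled to the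
   hyperboloid. *)
Lemma inner_points x (B : set 'rV[R]_3) : nbhs (vpos x) B ->
  exists P, [/\ B P, hyperbolic_plane P & forall j, 0 < lorentz P (simple_root x j)].
Proof.
move=> hB.
pose w t : 'rV[R]_3 := vpos x + t *: inpt x.
pose g t := - lorentz (w t) (w t).
pose P t := (Num.sqrt (g t))^-1 *: w t.
have [l1 l2] := pos_hyp x.
have g0 : g 0 = 1 by rewrite /g /w scale0r addr0 l1 opprK.
have gE t : g t = 1 - (2 * lorentz (vpos x) (inpt x)) * t - lorentz (inpt x) (inpt x) * (t * t).
  have e (a b : 'rV[R]_3) : lorentz (a + t *: b) (a + t *: b) =
      lorentz a a + 2 * lorentz a b * t + lorentz b b * (t * t).
    by rewrite lorentzDl !lorentzDr !lorentzZl !lorentzZr (lorentzC b a); ring.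
  by rewrite /g /w e l1; ring.
have cw : w t @[t --> (0 : R)] --> vpos x.
  have c : vpos x + t *: inpt x @[t --> (0 : R)] --> vpos x + 0 *: inpt x.
    by apply: cvgD; [exact: cvg_cst | apply: cvgZr_tmp; exact: cvg_id].
  by move: c; rewrite scale0r addr0.
have cg : g t @[t --> (0 : R)] --> (1 : R).
  have -> : g = fun t => 1 - (2 * lorentz (vpos x) (inpt x)) * t - lorentz (inpt x) (inpt x) * (t * t).
    by apply/funext => t; rewrite gE.
  move: (2 * _) (lorentz (inpt x) (inpt x)) => a b.
  have c : 1 - a * t - b * (t * t) @[t --> (0 : R)] --> 1 - a * 0 - b * (0 * 0).
    apply: cvgB; first apply: cvgB; first exact: cvg_cst.
      by apply: cvgMl_tmp; exact: cvg_id.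
    by apply: cvgMl_tmp; apply: cvgM; exact: cvg_id.
  by move: c; rewrite !mulr0 !subr0.
have cP : P t @[t --> (0 : R)] --> vpos x.
  have cs : Num.sqrt (g t) @[t --> (0 : R)] --> Num.sqrt (1 : R).
    by apply: (cvg_comp _ _ cg); exact: sqrt_continuous.
  have ci : (Num.sqrt (g t))^-1 @[t --> (0 : R)] --> (Num.sqrt (1 : R))^-1.
    by apply: cvgV cs; rewrite sqrtr1 oner_neq0.
  have := cvgZ ci cw; rewrite sqrtr1 invr1 scale1r. apply; exact: nbhs_filter.
have n1 : \forall t \near (0 : R), B (P t) by exact: cP.
have n2 : \forall t \near (0 : R), 0 < g t.
  exact: (cvgr_gt _ cg _ ltr01).
have n3 : \forall t \near (0 : R), 0 < w t 0 ord_max.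
  have c : w t 0 ord_max @[t --> (0 : R)] --> vpos x 0 ord_max.
    have e : (fun M : 'rV[R]_3 => M 0 ord_max) @ vpos x --> vpos x 0 ord_max.
      exact: coord_continuous.
    exact: cvg_comp _ _ cw e.
  exact: (cvgr_gt _ c _ l2).
have [t [t0 [h1 h2 h3]]] : exists t, 0 < t /\ [/\ B (P t), 0 < g t & 0 < w t 0 ord_max].
  have h : \forall t \near (0 : R), [/\ B (P t), 0 < g t & 0 < w t 0 ord_max].
    by near=> t; split; near: t.
  have [e /= e0 he] := (nbhs_ballP _ _).1 h; have e2 : 0 < e / 2 by rewrite divr_gt0.
  exists (e / 2); split => //; apply: he.
  by rewrite -ball_normE /= sub0r normrN gtr0_norm // ltr_pdivrMr // ltr_pMr // ltr1n.
have sg : 0 < Num.sqrt (g t) by rewrite sqrtr_gt0.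
exists (P t); split=> //.
  split; last by rewrite mxE mulr_gt0 ?invr_gt0.
  rewrite /P lorentzZl lorentzZr.
  have -> : lorentz (w t) (w t) = - Num.sqrt (g t) ^+ 2 by rewrite sqr_sqrtr ?ltW // opprK.
  by field; rewrite gt_eqF.
move=> j; rewrite /P lorentzZl mulr_gt0 ?invr_gt0 // /w lorentzDl lorentzZl.
by rewrite ltr_wpDl ?pos_chamber // mulr_gt0 // lorentz_inpt.
Unshelve. all: by end_near.
Qed.

(** Near a vertex of smaller level every point of the plane is in the union of belts, near one of
    larger level none is. A vertex of level i.+1 belongs to an inner face and is a limit of interior
    points of an outer face. *)
Lemma level_pos i x : @level R p q B0 i (vpos x) <-> size (addr x) = i.
Proof.
case: i => [|i].
  split=> [/= e|/size0nil e]; first by rewrite (_ : addr x = [::]) // -r_root; apply/addr_pos; rewrite e.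
  by rewrite /= B0E; apply/addr_pos; rewrite r_root.
set U := \bigcup_(j in [set j | (j <= i.+1)%N]) region (belt j).
rewrite -[level _ _ _ _]/(boundary U); split.
  move=> [_ h1 h2]; have st := star_nbhs x.
  have lo : ~ (size (addr x) <= i)%N.
    move=> le; have [P [[hP nU] [y [ey cy _]]]] := h2 _ st.
    apply: nU; apply/belts_regionE; exists y.
      by have := flevel_addr (sface_refl y); rewrite ey; lia.
    by split => //; exists y => //; exact: sface_refl.
  have hi : ~ (i.+1 < size (addr x))%N.
    move=> lt; have [P [/belts_regionE [z lz [_ [z' hz cz]]] [y [ey cy y0]]]] := h1 _ st.
    have [_ inv] := chambers_meet cz cy.
    have e : addr z' = addr y.
      apply: inv => k u; move: k; apply: ord3P => [h|_|_]; [by rewrite h ltxx in y0|exact: addr_fs1|exact: addr_fs2].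
    by have := flevel_addr hz; rewrite e ey; lia.
  lia.
move=> sx; split; first exact: pos_hyp.
  apply: subset_closure; apply/belts_regionE.
  have [|y ey ly] := inner_face hp hq (x := x); first by move=> e; rewrite e in sx.
  exists y; first by rewrite sx in ly; case: ly => ->.
  by have /addr_pos -> := esym ey; exact: vertex_in_cell (sface_refl _).
have [y ey ly] := outer_face hp hq x.
have /addr_pos <- := ey.
move=> B hB; have [P [hBP hP cP]] := inner_points hB.
exists P; split=> //; split=> // /belts_regionE [z lz [_ [z' hz cz]]].
have cy : chamber y P by move=> j; exact: ltW.
have [co inv] := chambers_meet cz cy.
have e : z' = y.
  by apply: (inv _ id) => k u h; move: (cP k); rewrite h ltxx.
have := sface_flevel hz; rewrite e ly sx; lia.
Qed.

Lemma level_vertexE i v : @level_vertex R p q B0 i v <->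
  exists2 x, v = vpos x & size (addr x) = i.
Proof.
split=> [[/mosaic_vertexE [x ->] /level_pos h]|[x -> h]]; first by exists x.
by split; [apply/mosaic_vertexE; exists x | apply/level_pos].
Qed.

(** * Trees *)

Definition flag_at (v : seq nat) : flag := insubd r (v, 0%N, true).

Lemma addr_flag_at v : vaddr p q v -> addr (flag_at v) = v.
Proof.
move=> hv; rewrite /addr /flag_at val_insubd /vflag /vdart /= hv /=.
by have -> : (0 < q)%N by lia.
Qed.

Lemma vaddr_addr (x : flag) : vaddr p q (addr x).
Proof. by case: x => -[[v k] b] h; case/andP: (h). Qed.

Lemma pos_flag_at x : vpos (flag_at (addr x)) = vpos x.
Proof. by apply/addr_pos; rewrite addr_flag_at // vaddr_addr. Qed.

Definition up_edges (i : nat) : set ('rV[R]_3 * 'rV[R]_3) :=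
  [set uv | exists x, [/\ uv = (vpos x, vpos (s0 x)), size (addr x) = i
    & size (addr (s0 x)) = i.+1]].

Lemma level_vertex_pos i x : @level_vertex R p q B0 i (vpos x) -> size (addr x) = i.
Proof.
move=> h; have [y e <-] := (level_vertexE _ _).1 h.
by congr size; apply/addr_pos.
Qed.

Lemma finite_level i : finite_set (@level_vertex R p q B0 i).
Proof.
apply: (@sub_finite_set _ _ ((vpos \o flag_at) @` [set` addrs p q i])).
  move=> v /level_vertexE [x -> sx]; exists (addr x); last exact: pos_flag_at.
  by rewrite /= mem_addrs vaddr_addr sx eqxx.
exact/finite_image/finite_seq.
Qed.

Lemma up_edges_admissible i : @admissible R p q B0 i (up_edges i).
Proof.
split.
- move=> u v [x [[-> ->] h1 h2]]; split; [apply/level_vertexE; exists x => //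
    |apply/level_vertexE; exists (s0 x) => //|apply/mosaic_edgeE; by exists x].
- move=> u u' v [x [[-> ->] h1 h2]] [y [[-> e] h3 h4]].
  have [|k hk ek] := @edge_up p q hp hq x; first by rewrite h1.
  have [|j hj ej] := @edge_up p q hp hq y; first by rewrite h3.
  by apply/addr_pos; move/addr_pos: e; rewrite ek ej => -[].
- move=> u /level_vertexE [x -> sx].
  have [y ey e] := edge_down hp hq (vaddr_addr x) (nout_gt0 hp hq (addr x)).
  exists (vpos (s0 y)), y; split; last by rewrite e /= sx.
    by congr (_, _); apply/addr_pos.
  by rewrite ey.
Qed.

Lemma admissible_sub i E' : @admissible R p q B0 i E' -> E' `<=` up_edges i.
Proof.
move=> [h _ _] [u v] /h [hu hv /mosaic_edgeE [x [eu ev]]].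
exists x; rewrite eu ev; split => //; apply: level_vertex_pos; by rewrite -?eu -?ev.
Qed.

Variable E : nat -> set ('rV[R]_3 * 'rV[R]_3).
Hypothesis hE : @tree_graphs R p q B0 E.

(** The set of all edges between the two levels is finite, admissible and contains every admissible
    set, so maximal cardinality forces equality. *)
Lemma tree_edges i : E i = up_edges i.
Proof.
have [h max] := hE i; apply: finite_card_le_eq; last exact: max (up_edges_admissible i).
  apply: (@sub_finite_set _ _ (@level_vertex R p q B0 i `*` @level_vertex R p q B0 i.+1)).
    move=> uv [x [-> h1 h2]]; split; apply/level_vertexE => /=; first by exists x.
    by exists (s0 x).
  by apply: finite_setX; exact: finite_level.
exact: admissible_sub.
Qed.

Lemma type_AE i v : @type_A R p q B0 E i.+1 v <->
  exists2 x, v = vpos x & size (addr x) = i.+1 /\ is_child p (addr x).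
Proof.
split.
  move=> [/level_vertexE [x -> sx] [u]]; rewrite tree_edges => -[y [[_ e] h1 h2]].
  exists x => //; split=> //.
  have [|k hk ek] := @edge_up p q hp hq y; first by rewrite h1.
  by move/addr_pos: e => ->; rewrite ek /= dvdn_mulr.
move=> [x -> [sx cx]]; split; first by apply/level_vertexE; exists x.
have vx := vaddr_addr x; case ex : (addr x) sx cx vx => [//|m u] /= [su] cx /andP[hm hu].
have [y ey e] := edge_down hp hq hu (div_nout hp hq hm).
exists (vpos y); rewrite tree_edges; exists y; split; last by rewrite e /= su.
  by congr (_, _); apply/addr_pos; rewrite ex e mulnC divnK.
by rewrite ey.
Qed.

Lemma type_BE i v : @type_B R p q B0 E i.+1 v <->
  exists2 x, v = vpos x & size (addr x) = i.+1 /\ ~~ is_child p (addr x).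
Proof.
split.
  move=> [/level_vertexE [x -> sx] nA]; exists x => //; split=> //.
  by apply/negP => cx; apply: nA; apply/type_AE; exists x.
move=> [x -> [sx cx]]; split; first by apply/level_vertexE; exists x.
by move=> /type_AE [y /addr_pos e [_ cy]]; move: cx; rewrite e cy.
Qed.

Lemma card_addrs (A : set 'rV[R]_3) i (a : pred (seq nat)) :
  (forall v, A v <-> exists2 x, v = vpos x & size (addr x) = i /\ a (addr x)) ->
  #|` fset_set A|%fset = count a (addrs p q i).
Proof.
move=> hA; pose s := [seq vpos (flag_at v) | v <- addrs p q i & a v].
have -> : A = [set` [fset v in s]%fset].
  apply/seteqP; split=> v; rewrite /= inE.
    move=> /hA [x -> [sx ax]]; apply/mapP; exists (addr x); last by rewrite pos_flag_at.
    by rewrite mem_filter ax mem_addrs vaddr_addr sx eqxx.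
  move=> /mapP [w]; rewrite mem_filter mem_addrs => /andP[aw /andP[vw /eqP sw]] ->.
  by apply/hA; exists (flag_at w); rewrite ?addr_flag_at.
rewrite set_fsetK card_fseq undup_id ?size_map ?size_filter //.
rewrite map_inj_in_uniq ?filter_uniq ?uniq_addrs // => v w.
rewrite !mem_filter !mem_addrs => /andP[_ /andP[vv _]] /andP[_ /andP[vw _]].
by move/addr_pos; rewrite !addr_flag_at.
Qed.

Lemma num_AE i : num_A p q B0 E i.+1 = nA p q i.+1.
Proof. by apply: card_addrs => v; exact: type_AE. Qed.

Lemma num_BE i : num_B p q B0 E i.+1 = nB p q i.+1.
Proof. by apply: card_addrs => v; exact: type_BE. Qed.

End MosaicGeometry.

(** * Limits of the ratios, and development from B0 *)

(** With z2 the other root, u (i+2) - z1 u (i+1) is geometric of ratio z2 < 1; dividing by u (i+1)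
    >= 1 bounds the distance of the ratio to z1. *)
Lemma ratio_cvg (R : realType) (u : nat -> nat) (C : nat) (z1 : R) :
  (2 < C)%N -> (forall i, 0 < u i.+1)%N ->
  (forall i, u i.+3 + u i.+1 = C * u i.+2)%N ->
  z1 = (C%:R + Num.sqrt (C%:R ^+ 2 - 4)) / 2 ->
  ((u i.+1)%:R / (u i)%:R : R) @[i --> \oo] --> z1.
Proof.
move=> hC u0 uS z1E.
pose c : R := C%:R; have c2 : 2 < c by rewrite /c ltr_nat.
have D0 : 0 < c ^+ 2 - 4 by nra.
pose s := Num.sqrt (c ^+ 2 - 4); have s2 : s ^+ 2 = c ^+ 2 - 4 by rewrite sqr_sqrtr // ltW.
have s0 : 0 < s by rewrite sqrtr_gt0.
pose z2 := (c - s) / 2.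
have z1E' : z1 = (c + s) / 2 by [].
have z12 : z1 * z2 = 1.
  have -> : z1 * z2 = (c ^+ 2 - s ^+ 2) / 4 by rewrite z1E' /z2; field.
  by rewrite s2; field.
have zD : z1 + z2 = c by rewrite z1E' /z2; field.
have z1_gt1 : 1 < z1 by rewrite z1E'; lra.
have z2_gt0 : 0 < z2.
  by have : 0 < z1 * z2 by [rewrite z12]; rewrite pmulr_rgt0 //; lra.
have z2_lt1 : z2 < 1 by nra.
pose v i : R := (u i.+1)%:R; pose d i := v i.+1 - z1 * v i.
have vS i : v i.+2 = c * v i.+1 - v i.
  by rewrite /v /c -natrM -uS natrD addrK.
have dE i : d i = z2 ^+ i * d 0%N.
  elim: i => [|i IH]; first by rewrite mul1r.
  rewrite exprS -mulrA -IH /d vS -zD.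
  have e : z1 * z2 * v i = v i by rewrite z12 mul1r.
  by lra.
(* The ratio at index 0 is dropped: the recurrence starts at index 1, and for [a] that ratio is a
   division by 0. *)
rewrite -cvg_shiftS /=.
have v1 i : 1 <= v i by rewrite /v ler1n u0.
have bound i : `|v i.+1 / v i - z1| <= `|d 0%N| * z2 ^+ i.
  have vi : 0 < v i by exact: lt_le_trans (v1 i).
  have -> : v i.+1 / v i - z1 = d i / v i by rewrite /d; field; rewrite gt_eqF.
  rewrite dE normrM normrM normfV (gtr0_norm vi) (ger0_norm (exprn_ge0 _ (ltW z2_gt0))).
  rewrite mulrC (mulrC (z2 ^+ i)) ler_piMl ?mulr_ge0 ?exprn_ge0 ?(ltW z2_gt0) //.
  by rewrite invf_le1.
have cz : `|d 0%N| * z2 ^+ i @[i --> \oo] --> (0 : R).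
  rewrite -(mulr0 `|d 0%N|); apply: cvgMl_tmp.
  by apply: cvg_expr; rewrite gtr0_norm.
have c1 : z1 - `|d 0%N| * z2 ^+ i @[i --> \oo] --> z1.
  by rewrite -[X in _ --> X]subr0; apply: cvgB => //; exact: cvg_cst.
have c3 : z1 + `|d 0%N| * z2 ^+ i @[i --> \oo] --> z1.
  by rewrite -[X in _ --> X]addr0; apply: cvgD => //; exact: cvg_cst.
apply: (squeeze_cvgr _ c1 c3); apply: nearW => i.
by have := bound i; rewrite ler_norml /v => /andP[h1 h2]; apply/andP; split; lra.
Qed.

Section Rooting.
Variables (R : realType) (p q : nat).
Hypotheses (hp : (3 < p)%N) (hq : (3 < q)%N) (hpq : (4 < (p - 2) * (q - 2))%N).

Local Notation K := (cox_gram R p q).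
Local Notation S := (simple_refl K).
Local Notation T := (S 0 *m S 1).

Definition frame_map (N : 'M[R]_3) (x : flag p q) : 'M[R]_3 :=
  dev (S ord_max) (S ord_max *m S 1) (S ord_max *m S 0) (S 1 *m S 0) x *m N.

Let K1 := cox_gram1 R p q.
Let Ksym := cox_gramC R p q.

Lemma frame_map_sw N i x :
  frame_map N (fsw hp hq i x) = S i *m frame_map N x.
Proof.
have S02 : S 0 *m S ord_max = S ord_max *m S 0.
  by apply: simple_reflC; [exact: Ksym | have [_ _ ->] := cox_gramE R p q].
have := dev_fsw hp hq (A := 'M[R]_3) (simple_reflK K1 0) (simple_reflK K1 1)
  (simple_reflK K1 ord_max) S02 erefl erefl erefl erefl
  (walk_order R hp hq hpq) (rot_order R hp hq hpq) i x.
rewrite /frame_map => ->; rewrite mulmxA; congr (_ *m _ *m _).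
by move: i; apply: ord3P.
Qed.

Let q0 : (0 < q)%N. Proof. exact: leq_ltn_trans hq. Qed.

Definition root_flag : flag p q := mkf true (isT : vaddr p q [::]) q0.

Lemma frame_map_root N : frame_map N root_flag = N.
Proof. by rewrite /frame_map /dev /dev_dart /= expr0 !mul1r mul1mx. Qed.

Lemma is_frame_map N x : is_frame p q N -> is_frame p q (frame_map N x).
Proof.
move=> hN; move: x; apply: (@fsw_ind p q hp hq _ root_flag).
  by move=> i x h; rewrite frame_map_sw; exact: is_frame_refl.
by rewrite frame_map_root.
Qed.

Lemma iter_frame_map N k x :
  frame_map N (iter k (frho hp hq) x) = T ^+ k *m frame_map N x.
Proof. exact: (Psi_iter (frame_map_sw N)). Qed.

(** Homogeneity of the mosaic: the frame of a flag at B0 serves as initial frame of a new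
    development. The known cell then carries label k at the root flag, so label 0 is p - k steps
    further on. *)
Lemma rooted_frame (B0 : 'rV[R]_3) : @mosaic_vertex R p q B0 ->
  exists (N : 'M[R]_3) (c0 : 'I_p -> 'rV[R]_3) (x0 : flag p q),
  [/\ is_frame p q N, @cell_vertices R p q c0, matches hp hq (frame_map N) c0 x0
    & B0 = vpos (frame_map N) root_flag].
Proof.
move=> [c hc [k ek]]; pose F := base_frame R p q.
have fF : is_frame p q F by exact: is_frame_base.
have mF : matches hp hq (frame_map F) (@base_cell R p q) root_flag.
  move=> j; rewrite base_cellE // /vpos iter_frame_map frame_map_root.
  by rewrite walk_exp_base_frame // /frame_vertex mulmxA mulmxKV ?base_frame_unit.
have [x hx] := cell_vertices_matches hpq (frame_map_sw F) (fun z => is_frame_map z fF)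
  (cell_base R p q) mF hc.
pose N := frame_map F (iter k (frho hp hq) x).
exists N, c, (iter (p - k) (frho hp hq) root_flag); split => //.
- exact: is_frame_map.
- move=> j; rewrite hx -iterD /vpos !iter_frame_map frame_map_root /N iter_frame_map.
  rewrite mulmxA; congr (frame_vertex _ _ (_ *m _)).
  rewrite -[RHS]/(T ^+ (j + (p - k)) * T ^+ k) -exprD -addnA subnK; last exact: ltnW.
  by rewrite exprD walk_order // mulr1.
- by rewrite ek hx /vpos frame_map_root.
Qed.

End Rooting.

Theorem theorem1 (R : realType) (p q : nat)
  (hp : (3 < p)%N) (hq : (3 < q)%N) (hpq : (4 < (p - 2) * (q - 2))%N)
  (B0 : 'rV[R]_3) (hB0 : mosaic_vertex p q B0)
  (E : nat -> set ('rV[R]_3 * 'rV[R]_3)) (hE : tree_graphs p q B0 E) :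
  let a := num_A p q B0 E in
  let b := num_B p q B0 E in
  let c : R := (p%:R - 2) * (q%:R - 2) - 2 in
  let z1 : R := (c + Num.sqrt (c ^+ 2 - 4)) / 2 in
  [/\ ((a i.+1)%:R / (a i)%:R : R) @[i --> \oo] --> z1,
      ((b i.+1)%:R / (b i)%:R : R) @[i --> \oo] --> z1 &
      ((a i.+1 + b i.+1)%:R / (a i + b i)%:R : R) @[i --> \oo] --> z1].
Proof.
move=> a b c z1.
have [N [c0 [x0 [fN hc0 m0 eB0]]]] := rooted_frame hp hq hpq hB0.
have aE i : a i.+1 = nA p q i.+1.
  exact: (num_AE hpq (frame_map_sw hp hq hpq N) (fun z => is_frame_map hp hq hpq z fN) hc0 m0
    (r := root_flag p hq) erefl eB0 hE i).
have bE i : b i.+1 = nB p q i.+1.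
  exact: (num_BE hpq (frame_map_sw hp hq hpq N) (fun z => is_frame_map hp hq hpq z fN) hc0 m0
    (r := root_flag p hq) erefl eB0 hE i).
pose C := ((p - 2) * (q - 2) - 2)%N; have hC : (2 < C)%N by rewrite /C; lia.
have cE : c = C%:R.
  by rewrite /c /C natrB; [rewrite natrM !natrB //; lia | lia].
have z1E : z1 = (C%:R + Num.sqrt (C%:R ^+ 2 - 4)) / 2 by rewrite /z1 cE.
have gt0 i := nAB_gt0 hp hq i.
split; apply: (ratio_cvg hC _ _ z1E) => i.
- by rewrite aE; case: (gt0 i).
- by rewrite !aE; exact: nA_rec2.
- by rewrite bE; case: (gt0 i).
- by rewrite !bE; exact: nB_rec2.
- by rewrite aE; case: (gt0 i) => h _; rewrite ltn_addr.
- rewrite !aE !bE mulnDr -(nA_rec2 hp hq) -(nB_rec2 hp hq); lia.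
Qed.
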